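(* For any $d\in\mathbb{N}^*$, $R>0$, $M>0$, there is $C>0$ such that the following holds. Let $\mu,\nu$ be probability measures on $\mathbb{R}^d$ compactly supported in $B_R$ such that $\mu(A)\le M\lambda(A)$ for any measurable set $A\subset\mathbb{R}^d$. Let $\bar\varphi$ be an $R$-Lipschitz optimal Brenier potential for $(\mu,\nu)$. Then for any $\phi\in\Gamma_0(\mathbb{R}^d)$ such that both $\phi$ and $\phi^*$ are $2R$-Lipschitz on $B_{2R}$, we have $$\int\|\nabla\bar\varphi(x)-\nabla\phi(x)\|\,d\mu(x)\le C\left(\int\phi\,d\mu+\int\phi^*\,d\nu-\left(\int\bar\varphi\,d\mu+\int\bar\varphi^*\,d\nu\right)\right)^{\frac14},$$ where $C=\max\left(268\sqrt R,\ 4(8R^3MC_{R,d})^{1/4}\right)$ with $$C_{R,d}=4\,\frac{e}{\sqrt{2\pi}\sqrt{\frac d2+1}}\left(\frac{64\pi e}{\frac d2+1}\right)^{\frac d2}48\,d^2(2R)^{d-1}.$$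
   Context: $B_R$ is the open Euclidean ball of $\mathbb{R}^d$ centered at $0$ with radius $R$; $\lambda$ is the Lebesgue measure. $\Gamma_0(\mathbb{R}^d)$ is the set of proper lower semicontinuous convex functions $\mathbb{R}^d\to\mathbb{R}\cup\{+\infty\}$; $\varphi^*(y)=\sup_{x}\langle x,y\rangle-\varphi(x)$. An optimal Brenier potential for $(\mu,\nu)$ is a function $\varphi\in\Gamma_0(\mathbb{R}^d)$ attaining $\inf_{\varphi\in\Gamma_0(\mathbb{R}^d)}\int\varphi\,d\mu+\int\varphi^*\,d\nu$. *)

(* Defs.v *)
From HB Require Import structures.
From mathcomp Require Import all_boot all_order all_algebra.
From mathcomp Require Import lra.
From mathcomp Require Import all_classical all_reals all_analysis.

Set Implicit Arguments.
Unset Strict Implicit.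
Unset Printing Implicit Defensive.

Import Order.TTheory GRing.Theory Num.Theory.
Import numFieldNormedType.Exports.

Local Open Scope classical_set_scope.
Local Open Scope ring_scope.

(* The Borel sigma-algebra: 'rV[K]_d is the measurable space R^d. *)
HB.instance Definition _ (K : realType) (m n : nat) :=
  @isMeasurable.Build (sigma_display (@open 'M[K]_(m, n))) 'M[K]_(m, n)
    <<s @open 'M[K]_(m, n) >> (@sigma_algebra0 _ setT _)
    (@sigma_algebraC _ _) (@sigma_algebra_bigcup _ setT _).

Section borel_mx.
Context {K : realType}.

Lemma open_measurable_mx m n (U : set 'M[K]_(m, n)) : open U -> measurable U.
Proof. by move=> oU; exact: sub_sigma_algebra. Qed.

Lemma measurable_coord m n i j :
  measurable_fun setT (fun A : 'M[K]_(m, n) => A i j : measurableTypeR K).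
Proof.
apply: (measurability _ (measurable_realfun.RGenOpens.measurableE K)) => _ [_ [a [b ->]] <-].
rewrite setTI; apply: open_measurable_mx; apply: open_comp => //.
by move=> + _; apply: coord_continuous.
Qed.

Lemma rational_box m n (U : set 'M[K]_(m, n)) (A : 'M[K]_(m, n)) :
  open U -> U A -> exists a b : 'M[rat]_(m, n),
    [set B : 'M[K]_(m, n) | forall i j, ratr (a i j) < B i j < ratr (b i j)]
      `<=` U /\ forall i j, ratr (a i j) < A i j < ratr (b i j).
Proof.
rewrite openE => /[apply] /nbhs_ballP[e /= e0 eU].
have /choice[a aP] (ij : 'I_m * 'I_n) :
    exists q : rat, A ij.1 ij.2 - e < ratr q < A ij.1 ij.2.
  have /rat_in_itvoo[q] : A ij.1 ij.2 - e < A ij.1 ij.2 by rewrite ltrBlDr ltrDl.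
  by rewrite in_itv /= => ?; exists q.
have /choice[b bP] (ij : 'I_m * 'I_n) :
    exists q : rat, A ij.1 ij.2 < ratr q < A ij.1 ij.2 + e.
  have /rat_in_itvoo[q] : A ij.1 ij.2 < A ij.1 ij.2 + e by rewrite ltrDl.
  by rewrite in_itv /= => ?; exists q.
exists (\matrix_(i, j) a (i, j)), (\matrix_(i, j) b (i, j)); split.
  move=> B abB; apply: eU; split => // i j; rewrite /ball /= ltr_norml.
  have := abB i j; rewrite !mxE => /andP[aB Bb].
  have /andP[Aea _] := aP (i, j); have /andP[_ bAe] := bP (i, j).
  rewrite /= in Aea bAe.
  by apply/andP; split; lra.
by move=> i j; rewrite !mxE; have /andP[_ ->] := aP (i, j); have /andP[->] := bP (i, j).
Qed.

(* 'rV_n.+1 is identified with K * 'rV_n, first coordinate first. *)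
Definition rV_cons n (p : measurableTypeR K * 'rV[K]_n) : 'rV[K]_n.+1 :=
  \row_j if unlift ord0 j is Some k then p.2 ord0 k else p.1.

Definition rV_uncons n (v : 'rV[K]_n.+1) : measurableTypeR K * 'rV[K]_n :=
  (v ord0 ord0, \row_k v ord0 (lift ord0 k)).

Lemma rV_consK n : cancel (@rV_cons n) (@rV_uncons n).
Proof.
move=> [x v]; rewrite /rV_uncons /rV_cons mxE unlift_none; congr (_, _).
by apply/rowP => k; rewrite !mxE liftK.
Qed.

Lemma rV_unconsK n : cancel (@rV_uncons n) (@rV_cons n).
Proof.
by move=> v; apply/rowP => j; rewrite mxE; case: unliftP => [k|] ->; rewrite ?mxE.
Qed.

Lemma measurable_rV_uncons n : measurable_fun setT (@rV_uncons n).
Proof.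
apply/measurable_fun_pairP; split; first exact: measurable_coord.
apply: (@measurability _ _ _ _ _ _ (@open 'rV[K]_n)) => // _ [U oU <-].
rewrite setTI; apply: open_measurable_mx.
apply: open_comp => // v _ B [P vP PB].
exists (fun i j => if unlift ord0 j is Some k then P i k else setT).
  move=> i j; case: unliftP => [k ->|_]; last exact: filterT.
  by have := vP i k; rewrite mxE (ord1 i).
move=> w wP; apply: PB => i k; have := wP i (lift ord0 k).
by rewrite liftK mxE (ord1 i).
Qed.

Lemma measurable_rV_cons n : measurable_fun setT (@rV_cons n).
Proof.
apply: (@measurability _ _ _ _ _ _ (@open 'rV[K]_n.+1)) => // _ [U oU <-].
rewrite setTI.
pose box (ab : 'rV[rat]_n.+1 * 'rV[rat]_n.+1) := [set v : 'rV[K]_n.+1 |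
  forall i j, ratr (ab.1 i j) < v i j < ratr (ab.2 i j)].
have -> : U = \bigcup_ab (if `[< box ab `<=` U >] then box ab else set0).
  apply/seteqP; split=> [v Uv|v [ab _]]; last by case: asboolP => // bU /bU.
  by have [a [b [abU vab]]] := rational_box oU Uv; exists (a, b) => //; case: asboolP.
rewrite preimage_bigcup; apply: countable_bigcupT_measurable => // ab.
case: asboolP => [_|_]; last by rewrite preimage_set0.
have -> : @rV_cons n @^-1` box ab =
    `]ratr (ab.1 ord0 ord0), ratr (ab.2 ord0 ord0)[%classic `*`
    \bigcap_(j in [set: 'I_n]) [set v : 'rV[K]_n | v ord0 j \in
      `]ratr (ab.1 ord0 (lift ord0 j)), ratr (ab.2 ord0 (lift ord0 j))[].
  apply/seteqP; split => [[x v] /= xv|[x v] /= [xab vab] i j].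
    split; first by have := xv ord0 ord0; rewrite mxE unlift_none in_itv.
    by move=> j _ /=; have := xv ord0 (lift ord0 j); rewrite mxE liftK in_itv.
  rewrite (ord1 i) mxE; case: unliftP => [k ->|-> //].
  by have := vab k I; rewrite /= in_itv.
apply: measurableX => //.
apply: fin_bigcap_measurable => // j _.
have := @measurable_coord 1 n ord0 j measurableT
  `]ratr (ab.1 ord0 (lift ord0 j)), ratr (ab.2 ord0 (lift ord0 j))[%classic.
rewrite setTI; apply; exact: measurable_itv.
Qed.

End borel_mx.

Section lebesgue_rV.
Context {K : realType}.
Local Open Scope ereal_scope.

Section step.
Context n (mu : {sigma_finite_measure set 'rV[K]_n -> \bar K}).

Definition lebesgue_rVS : set 'rV[K]_n.+1 -> \bar K :=
  pushforward (@lebesgue_measure K \x mu) (@rV_cons K n).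

Let lebesgue_rVS0 : lebesgue_rVS set0 = 0.
Proof. by rewrite /lebesgue_rVS /pushforward preimage_set0 measure0. Qed.

Let lebesgue_rVS_ge0 A : 0 <= lebesgue_rVS A.
Proof. by rewrite /lebesgue_rVS /pushforward measure_ge0. Qed.

Let lebesgue_rVS_sigma_additive : semi_sigma_additive lebesgue_rVS.
Proof.
apply: measure_semi_sigma_additive; exact: measurable_rV_cons.
Qed.

HB.instance Definition _ := isMeasure.Build _ _ _ lebesgue_rVS
  lebesgue_rVS0 lebesgue_rVS_ge0 lebesgue_rVS_sigma_additive.

Let lebesgue_rVS_sigma_finite : sigma_finite setT lebesgue_rVS.
Proof.
have /sigma_finiteP[F [FT ndF Foo]] := sigma_finiteT (@lebesgue_measure K).
have /sigma_finiteP[G [GT ndG Goo]] := sigma_finiteT mu.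
exists (fun i => @rV_uncons K n @^-1` (F i `*` G i)).
  rewrite -preimage_bigcup; apply/esym/seteqP; split=> // v _ /=.
  have [i _ Fi] : (\bigcup_i F i) (v ord0 ord0) by rewrite -FT.
  have [j _ Gj] : (\bigcup_i G i) (rV_uncons v).2 by rewrite -GT.
  exists (maxn i j) => //; split => /=.
    by move: Fi; exact/subsetPset/ndF/leq_maxl.
  by move: Gj; exact/subsetPset/ndG/leq_maxr.
move=> i; have [mF Fi] := Foo i; have [mG Gi] := Goo i; split.
  rewrite -[X in measurable X]setTI; apply: measurable_rV_uncons => //.
  exact: measurableX.
rewrite /lebesgue_rVS /pushforward -comp_preimage.
rewrite (_ : @rV_uncons K n \o _ = id); last first.
  by apply/funext => p /=; rewrite rV_consK.
by rewrite preimage_id product_measure1E// lte_mul_pinfty// ge0_fin_numE.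
Qed.

HB.instance Definition _ := Measure_isSigmaFinite.Build _ _ _ lebesgue_rVS
  lebesgue_rVS_sigma_finite.

End step.

(* Lebesgue measure on R^n: the n-fold product of lebesgue_measure, transported
   to 'rV[K]_n; see lebesgue_rV_box for its values on boxes. *)
Fixpoint lebesgue_rV n : {sigma_finite_measure set 'rV[K]_n -> \bar K} :=
  match n with
  | 0 => \d_(0%R : 'rV[K]_0)
  | m.+1 => lebesgue_rVS (lebesgue_rV m)
  end.

Lemma lebesgue_rV_box n (A : 'I_n -> set (measurableTypeR K)) :
  (forall i, measurable (A i)) ->
  lebesgue_rV n [set v | forall i, A i (v ord0 i)] =
  \prod_(i < n) lebesgue_measure (A i).
Proof.
elim: n A => [A _|n IH A mA].
  by rewrite big_ord0 /= diracE mem_set// => -[].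
rewrite big_ord_recl.
transitivity ((@lebesgue_measure K \x lebesgue_rV n)
    (A ord0 `*` [set v : 'rV[K]_n | forall i, A (lift ord0 i) (v ord0 i)])).
  rewrite -[LHS]/((@lebesgue_measure K \x lebesgue_rV n) (@rV_cons K n @^-1` _)).
  congr (_ _); apply/seteqP; split => [[x v] /= xv|[x v] /= [Ax Av] i].
    split; first by have := xv ord0; rewrite mxE unlift_none.
    by move=> i; have := xv (lift ord0 i); rewrite mxE liftK.
  by rewrite mxE; case: unliftP => [k|] ->.
rewrite product_measure1E//; last first.
  rewrite (_ : [set v | _] = \bigcap_(j in [set: 'I_n])
      [set v : 'rV[K]_n | A (lift ord0 j) (v ord0 j)]); last first.
    by apply/seteqP; split => v /= Av j => [_|]; exact: Av.
  apply: fin_bigcap_measurable => // j _.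
  rewrite -[X in measurable X]setTI.
  exact: (@measurable_coord K 1 n ord0 j measurableT _ (mA _)).
by rewrite -(IH (fun i => A (lift ord0 i))).
Qed.

End lebesgue_rV.

Section euclidean.
Context {K : realType} {d : nat}.
Implicit Types (x y : 'rV[K]_d) (f : 'rV[K]_d -> \bar K) (A : set 'rV[K]_d).

Definition dotp x y : K := \sum_(i < d) x ord0 i * y ord0 i.

(* The library norm `|x| on 'rV[K]_d is the sup norm; it defines the same
   topology and the same differentiability, but not the same Lipschitz
   constants nor the same balls. *)
Definition enorm x : K := Num.sqrt (dotp x x).

Definition eball (r : K) : set 'rV[K]_d := [set x | enorm x < r].

Definition msupport (mu : set 'rV[K]_d -> \bar K) : set 'rV[K]_d :=
  [set x | forall U, open U -> U x -> (0 < mu U)%E].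

Definition compactly_supported_in (mu : set 'rV[K]_d -> \bar K) A : Prop :=
  compact (msupport mu) /\ msupport mu `<=` A.

(* Products are those of \bar K, where 0 * +oo = 0. *)
Definition econvex f : Prop := forall (t : K) x y, 0 <= t <= 1 ->
  (f (t *: x + (1 - t) *: y)%R <= t%:E * f x + (1 - t)%:E * f y)%E.

Definition Gamma0 : set ('rV[K]_d -> \bar K) :=
  [set f | [/\ forall x, f x != -oo%E, exists x, f x != +oo%E,
               lower_semicontinuous f & econvex f]].

Definition conjugate f : 'rV[K]_d -> \bar K :=
  fun y => ereal_sup (range (fun x => (dotp x y)%:E - f x)%E).

Definition elipschitz_on A (k : K) f : Prop :=
  (forall x, A x -> f x \is a fin_num) /\
  (forall x y, A x -> A y -> (`|f x - f y| <= (k * enorm (x - y))%:E)%E).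

(* Meaningful only where f is finite around x and differentiable at x;
   elsewhere the value is a default one. *)
Definition gradient f x : 'rV[K]_d :=
  \row_(i < d) 'D_(delta_mx ord0 i) (fine \o f) x.

Definition kantorovich (mu nu : {measure set 'rV[K]_d -> \bar K}) f : \bar K :=
  (\int[mu]_x f x + \int[nu]_y conjugate f y)%E.

Definition brenier_potential (mu nu : {measure set 'rV[K]_d -> \bar K}) f :
    Prop :=
  Gamma0 f /\ kantorovich mu nu f = ereal_inf (kantorovich mu nu @` Gamma0).

End euclidean.

Definition cst_Rd {K : realType} (r : K) (d : nat) : K :=
  4 * (expR 1 / (Num.sqrt (2 * pi) * Num.sqrt (d%:R / 2 + 1)))
    * ((64 * pi * expR 1) / (d%:R / 2 + 1)) `^ (d%:R / 2)
    * 48 * d%:R ^+ 2 * (2 * r) ^+ d.-1.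

Definition stability_cst {K : realType} (d : nat) (r M : K) : K :=
  Num.max (268 * Num.sqrt r) (4 * (8 * r ^+ 3 * M * cst_Rd r d) `^ (1 / 4)).

(* Main.v *)
Require Import Defs.
From mathcomp Require Import all_boot all_order all_algebra.
From mathcomp Require Import ring lra.
From mathcomp Require Import all_classical all_reals all_analysis.
From mathcomp Require Import measurable_realfun normal_distribution.

Set Implicit Arguments.
Unset Strict Implicit.
Unset Printing Implicit Defensive.

Import Order.TTheory GRing.Theory Num.Theory.
Import numFieldNormedType.Exports.

Local Open Scope classical_set_scope.
Local Open Scope ring_scope.

(** Write [F] for the optimal potential, [f] for the other one, [delta] for the gap of
    the Kantorovich functional [J], and [D_i^t h x] for the second difference
    [h (x + t e_i) + h (x - t e_i) - 2 h x] of [h].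

    Optimality is used through one competitor, the conjugate [g] of the mean of the
    conjugates of [F] and [f].  From [J F <= J g] the function [P = F + f - 2 g] has
    [mu]-integral at most [delta] ([kantorovich_gap]).  For every [v], [g x] is below the
    mean of [F (x - v)] and [f (x + v)], so [P x] is at least
    [F x - F (x - v) + f x - f (x + v)].  At points of differentiability, convexity of
    [F] and [f] then gives, with [v = t e_i] and [v = - t e_i],
      [t * |d_i F x - d_i f x| <= P x + D_i^t F x + D_i^t f x]
    ([derive_diff_le]).

    The second differences of a convex Lipschitz function have an integral of order
    [t ^ 2] over a ball: one power of [t] comes from the Lipschitz bound, the other one from a
    discrete integration by parts ([integral_sdiff_le]).  The same estimate shows that
    convex functions have partial derivatives almost everywhere
    ([negligible_not_derivable]).  Summing over [i] and integrating, with [V] the volume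
    of the ball of radius [2 R], the left side of the theorem is at most
      [d delta / t + 6 d M V t]  for [0 < t < R / 2],
    and it is at most [3 R d] by the Lipschitz bounds.  For a fixed density bound this
    gives the exponent 1/2; the exponent 1/4 follows from it and from the trivial bound
    ([optimal_scale]), once [216 R^2 d^4 M V <= C^4] and [1 <= M V] are known.  The first
    of these compares a Gaussian bound for [V] ([lebesgue_rV_eball_le]) with the
    dimensional constant ([cst_Rd_ge]); the second holds because [mu] is a probability
    carried by the ball. *)

(** * The Euclidean norm *)

Section euclidean_space.
Context {K : realType} {d : nat}.
Implicit Types x y z v : 'rV[K]_d.

Lemma dotpC x y : dotp x y = dotp y x.
Proof. by apply: eq_bigr => i _; rewrite mulrC. Qed.

Lemma dotpDl x y z : dotp (x + y) z = dotp x z + dotp y z.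
Proof. by rewrite -big_split; apply: eq_bigr => i _; rewrite mxE mulrDl. Qed.

Lemma dotpZl (a : K) x y : dotp (a *: x) y = a * dotp x y.
Proof. by rewrite mulr_sumr; apply: eq_bigr => i _; rewrite mxE mulrA. Qed.

Lemma dotpDr x y z : dotp x (y + z) = dotp x y + dotp x z.
Proof. by rewrite dotpC dotpDl !(dotpC x). Qed.

Lemma dotpZr (a : K) x y : dotp x (a *: y) = a * dotp x y.
Proof. by rewrite dotpC dotpZl dotpC. Qed.

Lemma dotpp_ge0 x : 0 <= dotp x x.
Proof. by apply: sumr_ge0 => i _; rewrite -expr2 sqr_ge0. Qed.

Lemma enorm_ge0 x : 0 <= enorm x.
Proof. exact: sqrtr_ge0. Qed.

Lemma sqr_enorm x : enorm x ^+ 2 = dotp x x.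
Proof. by rewrite sqr_sqrtr// dotpp_ge0. Qed.

Lemma enorm0 : enorm (0 : 'rV[K]_d) = 0.
Proof. by rewrite /enorm /dotp big1 ?sqrtr0// => i _; rewrite mxE mul0r. Qed.

Lemma enormZ (a : K) x : enorm (a *: x) = `|a| * enorm x.
Proof. by rewrite /enorm dotpZl dotpZr mulrA -expr2 sqrtrM ?sqr_ge0// sqrtr_sqr. Qed.

Lemma enormN x : enorm (- x) = enorm x.
Proof. by rewrite -scaleN1r enormZ normrN1 mul1r. Qed.

Lemma enorm_delta (a : K) (i : 'I_d) : enorm (a *: delta_mx ord0 i) = `|a|.
Proof.
rewrite enormZ /enorm /dotp (bigD1 i)//= big1 => [|j ji].
  by rewrite mxE !eqxx mulr1 addr0 sqrtr1 mulr1.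
by rewrite mxE (negbTE ji) andbF mul0r.
Qed.

(** Cauchy-Schwarz, from the sign of the squared norm of
    [enorm y *: x - enorm x *: y]. *)
Lemma dotp_le x y : dotp x y <= enorm x * enorm y.
Proof.
have [x0|x0] := eqVneq (enorm x * enorm y) 0.
  rewrite x0.
  suff z0 v : enorm v = 0 -> v = 0.
    move: x0 => /eqP; rewrite mulf_eq0 => /orP[]/eqP/z0 ->.
      by rewrite /dotp big1// => i _; rewrite mxE mul0r.
    by rewrite /dotp big1// => i _; rewrite mxE mulr0.
  move=> /(congr1 (fun t => t ^+ 2)); rewrite sqr_enorm expr0n /= => /eqP.
  rewrite psumr_eq0 => [/allP v0|i _]; last by rewrite -expr2 sqr_ge0.
  apply/rowP => i; rewrite mxE.
  by have := v0 i; rewrite mem_index_enum -expr2 sqrf_eq0 => /(_ isT)/eqP.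
have := dotpp_ge0 (enorm y *: x - enorm x *: y).
rewrite -scaleNr !dotpDl !dotpDr !dotpZl !dotpZr -!sqr_enorm (dotpC y x).
have : 0 < enorm x * enorm y by rewrite lt_def x0 mulr_ge0 ?enorm_ge0.
set a := enorm x; set b := enorm y; set c := dotp x y => ab0.
have -> : b * (b * a ^+ 2) + b * (- a * c) + (- a * (b * c) + - a * (- a * b ^+ 2))
  = 2 * (a * b) * (a * b - c) by ring.
by rewrite pmulr_rge0 ?subr_ge0// mulr_gt0.
Qed.

Lemma enormD x y : enorm (x + y) <= enorm x + enorm y.
Proof.
rewrite -(@ler_pXn2r _ 2)// ?nnegrE ?addr_ge0 ?enorm_ge0//.
rewrite sqrrD !sqr_enorm dotpDl !dotpDr (dotpC y x).
by have := dotp_le x y; lra.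
Qed.

Lemma enorm_distD x y : `|enorm (x + y) - enorm x| <= enorm y.
Proof.
rewrite ler_norml; apply/andP; split; last by rewrite lerBlDl enormD.
by have := enormD (x + y) (- y); rewrite addrK enormN; lra.
Qed.

Lemma enorm_le_sum x : enorm x <= \sum_(i < d) `|x ord0 i|.
Proof.
rewrite [in leLHS](row_sum_delta x).
elim/big_ind2 : _ => [||i _]; first by rewrite enorm0.
  by move=> a b c e ab ce; rewrite (le_trans (enormD _ _))// lerD.
by rewrite enorm_delta.
Qed.

Lemma eball_convex (r t : K) x y : 0 <= t <= 1 -> eball r x -> eball r y ->
  eball r (t *: x + (1 - t) *: y).
Proof.
move=> /andP[t0 t1] /= xr yr; rewrite /eball /=; apply: le_lt_trans (enormD _ _) _.
rewrite !enormZ !ger0_norm ?subr_ge0//; rewrite /eball /= in xr yr.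
have [t0'|tn0] := eqVneq t 0; first by rewrite t0' mul0r add0r subr0 mul1r.
have : 0 < t by rewrite lt_def tn0.
by have := subr_ge0 t 1; rewrite t1 => /idP; nra.
Qed.

End euclidean_space.

(** * Borel measurability *)

Section measurability.
Context {K : realType}.

Lemma continuous_measurable_rV n (f : 'rV[K]_n -> K) :
  continuous f -> measurable_fun setT (f : _ -> measurableTypeR K).
Proof.
move=> cf.
apply: (measurability _ (RGenOpens.measurableE K)) => _ [_ [a [b ->]] <-].
rewrite setTI; apply: open_measurable_mx; exact: open_comp.
Qed.

Lemma continuous_measurable_rVrV m n (f : 'rV[K]_m -> 'rV[K]_n) :
  continuous f -> measurable_fun setT f.
Proof.
move=> cf; apply: (@measurability _ _ _ _ _ _ (@open 'rV[K]_n)) => // _ [U oU <-].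
by rewrite setTI; apply: open_measurable_mx; exact: open_comp.
Qed.

Lemma lsc_measurable n (f : 'rV[K]_n -> \bar K) :
  lower_semicontinuous f -> measurable_fun setT f.
Proof.
move=> lf; apply: (measurability _ (ErealGenOInfty.measurableE K)).
move=> _ [_ [a ->] <-]; rewrite setTI; apply: open_measurable_mx.
by rewrite preimage_itvoy; move/lower_semicontinuousP : lf; exact.
Qed.

Lemma enorm_continuous n : continuous (@enorm K n).
Proof.
have cd : continuous (fun x : 'rV[K]_n => dotp x x).
  apply: continuous_big => [|i _ x]; first exact: add_continuous.
  by apply: (@continuousM K); exact: coord_continuous.
move=> x; apply: (@continuous_comp _ _ _ (fun x : 'rV[K]_n => dotp x x) Num.sqrt x (cd x)).
exact: sqrt_continuous.
Qed.

Lemma measurable_enorm n : measurable_fun setT (@enorm K n : _ -> measurableTypeR K).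
Proof. by apply: continuous_measurable_rV; exact: enorm_continuous. Qed.

Lemma open_eball n (r : K) : open (@eball K n r).
Proof.
rewrite (_ : eball r = enorm @^-1` [set t | t < r])//.
by apply: open_comp => // x _; exact: enorm_continuous.
Qed.

Lemma measurable_eball n (r : K) : measurable (@eball K n r).
Proof. by apply: open_measurable_mx; exact: open_eball. Qed.

Lemma measurable_translation n (v : 'rV[K]_n) : measurable_fun setT (fun x : 'rV[K]_n => x + v).
Proof.
apply: continuous_measurable_rVrV => x B [P xP PB].
exists (fun i j => (fun t => t + v i j) @^-1` P i j) => [i j|y yP].
  have := xP i j; rewrite mxE; move: (P i j).
  have c : continuous (fun t : K => t + v i j).
    by move=> t; apply: continuousD => //; exact: cst_continuous.
  exact: c.
by apply: PB => i j; have := yP i j; rewrite /= mxE.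
Qed.

End measurability.

(** * Lebesgue measure: translations and balls *)

Section lebesgue_rV_theory.
Context {K : realType}.
Local Notation leb := (@lebesgue_measure K).

Let measurable_shift (a : K) :
  measurable_fun setT (fun x : measurableTypeR K => (x + a : measurableTypeR K)).
Proof. exact: measurable_funD. Qed.

Lemma lebesgue_measure_translation (a : K) (A : set (measurableTypeR K)) :
  measurable A -> leb ((fun x => x + a) @^-1` A) = leb A.
Proof.
move=> mA; apply/esym.
have ma := measurable_shift a.
pose lebA := pushforward leb (fun x => x + a : measurableTypeR K).
apply: (lebesgue_measure_unique (mu := lebA)) => // _ [[b c]] _ <-.
transitivity (leb `]b - a, c - a]%classic); last first.
  rewrite /pushforward; congr (leb _).
  by apply/seteqP; split => x /=; rewrite !in_itv /= ltrBlDr lerBrDr.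
by rewrite !lebesgue_measure_itv /= !lte_fin ltrD2r -!EFinD opprB addrA subrK.
Qed.


Lemma lebesgue_rVE n (A : set 'rV[K]_n.+1) :
  lebesgue_rV n.+1 A = (leb \x lebesgue_rV n)%E (@rV_cons K n @^-1` A).
Proof. by []. Qed.

(** Both sides are measures in [A], so on the product it is enough to compare
    them on rectangles. *)
Lemma lebesgue_rV_translation n (v : 'rV[K]_n) (A : set 'rV[K]_n) :
  measurable A -> lebesgue_rV n ((fun x => x + v) @^-1` A) = lebesgue_rV n A.
Proof.
elim: n v A => [v A mA|n IH v A mA].
  by congr (lebesgue_rV 0 _); apply/funext => x; rewrite /= [x + v]thinmx0 [x]thinmx0.
pose v' := (rV_uncons v).2.
pose tr (p : measurableTypeR K * 'rV[K]_n) : measurableTypeR K * 'rV[K]_n :=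
  (p.1 + v ord0 ord0, p.2 + v').
have mtr : measurable_fun setT tr.
  apply/measurable_fun_pairP; split.
    by apply: (measurableT_comp (measurable_shift _)).
  by apply: (measurableT_comp (measurable_translation v')).
have mA' : measurable (@rV_cons K n @^-1` A).
  by rewrite -[X in measurable X]setTI; apply: measurable_rV_cons.
rewrite !lebesgue_rVE.
have -> : @rV_cons K n @^-1` ((fun x => x + v) @^-1` A) = tr @^-1` (@rV_cons K n @^-1` A).
  apply/funext => p; rewrite /preimage /=; congr (A _).
  by apply/rowP => j; rewrite !mxE; case: unliftP => [k ->|->]; rewrite ?mxE.
apply/esym/(product_measure_unique (m' := pushforward (leb \x lebesgue_rV n)%E tr)) => //.
move=> B C mB mC.
rewrite -[LHS]/((leb \x lebesgue_rV n)%E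
  (((fun x => x + v ord0 ord0) @^-1` B) `*` ((fun x => x + v') @^-1` C))).
rewrite product_measure1E.
- by congr (_ * _)%E; [exact: lebesgue_measure_translation|exact: IH].
- by rewrite -[X in measurable X]setTI; exact: measurable_shift.
- by rewrite -[X in measurable X]setTI; apply: measurable_translation.
Qed.

Lemma ge0_integral_translation n (v : 'rV[K]_n) (f : 'rV[K]_n -> \bar K) :
  measurable_fun setT f -> (forall x, 0 <= f x)%E ->
  (\int[lebesgue_rV n]_x f (x + v)%R = \int[lebesgue_rV n]_x f x)%E.
Proof.
move=> mf f0; have mtr := measurable_translation v.
rewrite -[LHS](@ge0_integral_pushforward _ _ _ _ _ _ mtr _ setT f)//.
by apply: eq_measure_integral => A mA _; exact: lebesgue_rV_translation.
Qed.

Lemma integral_translation n (v : 'rV[K]_n) (f : 'rV[K]_n -> \bar K) :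
  (lebesgue_rV n).-integrable setT f ->
  (\int[lebesgue_rV n]_x f (x + v)%R = \int[lebesgue_rV n]_x f x)%E.
Proof.
move=> /integrableP[mf foo]; have mtr := measurable_translation v.
rewrite -[LHS](@integral_pushforward _ _ _ _ _ _ mtr _ setT f)//.
  by apply: eq_measure_integral => A mA _; exact: lebesgue_rV_translation.
apply/integrableP; split; first exact: measurableT_comp.
rewrite (ge0_integral_translation v (f := fun x => `|f x|%E))//.
exact: measurableT_comp.
Qed.

End lebesgue_rV_theory.

Section ball_volume.
Context {K : realType}.
Local Notation leb := (@lebesgue_measure K).

Lemma measurable_prod_coord n (g : K -> K) : measurable_fun setT g ->
  measurable_fun setT (fun x : 'rV[K]_n => \prod_(i < n) g (x ord0 i)).
Proof.
move=> mg; elim: (index_enum _) => [|i s IH].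
  by under eq_fun do rewrite big_nil; exact: measurable_cst.
under eq_fun do rewrite big_cons; apply: measurable_funM => //.
by apply: (measurableT_comp mg); exact: measurable_coord.
Qed.

(** Tonelli peels off one coordinate at a time; with [g] of integral 1 the value does
    not change along the induction on the dimension. *)
Lemma integral_prod_coord n (g : K -> K) : measurable_fun setT g ->
  (forall t, 0 <= g t) -> (\int[leb]_t (g t)%:E = 1)%E ->
  (\int[lebesgue_rV n]_x (\prod_(i < n) g (x ord0 i))%:E = 1)%E.
Proof.
move=> mg g0 g1; elim: n => [|n IH].
  rewrite /= integral_dirac//.
    by rewrite diracE in_setT mul1e big_ord0.
  by apply/measurable_EFinP; exact: measurable_prod_coord.
have mG m : measurable_fun setT (fun x : 'rV[K]_m => (\prod_(i < m) g (x ord0 i))%:E).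
  by apply/measurable_EFinP; exact: measurable_prod_coord.
have G0 m (x : 'rV[K]_m) : (0 <= (\prod_(i < m) g (x ord0 i))%:E)%E.
  by rewrite lee_fin prodr_ge0.
rewrite [LHS](@ge0_integral_pushforward _ _ _ _ _ _ (measurable_rV_cons (n := n))
  (leb \x lebesgue_rV n)%E setT)//.
have mGc := measurableT_comp (mG n.+1) (@measurable_rV_cons K n).
rewrite preimage_setT fubini_tonelli1//; last by move=> x; exact: G0.
rewrite -[RHS]g1; apply: eq_integral => t _.
rewrite -[RHS]mule1 -IH -ge0_integralZl//; last by rewrite lee_fin.
apply: eq_integral => y _; rewrite /= big_ord_recl -EFinM mxE unlift_none; congr (_ * _)%:E.
by apply: eq_bigr => i _; rewrite mxE liftK.
Qed.

(** Chernoff's bound: the product of centred Gaussian densities of variance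
    [r ^+ 2 / n] has integral 1 and is smallest on the ball at its boundary. *)
Lemma lebesgue_rV_eball_le n (r : K) : (0 < n)%N -> 0 < r ->
  (lebesgue_rV n (eball r) <= ((r * Num.sqrt (2 * pi * expR 1 / n%:R)) ^+ n)%:E)%E.
Proof.
move=> n0 r0; pose s : K := r / Num.sqrt n%:R.
have n0' : 0 < n%:R :> K by rewrite ltr0n.
have s0 : 0 < s by rewrite divr_gt0// sqrtr_gt0.
have s2 : s ^+ 2 = r ^+ 2 / n%:R by rewrite expr_div_n sqr_sqrtr// ltW.
have sn0 : s != 0 by rewrite gt_eqF.
have pk0 := normal_peak_gt0 sn0.
pose c := normal_peak s ^+ n * expR (- (n%:R / 2)).
have c0 : 0 < c by rewrite mulr_gt0 ?expR_gt0// exprn_gt0.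
have mF : measurable_fun setT (fun x : 'rV[K]_n => (\prod_(i < n) normal_pdf 0 s (x ord0 i))%:E).
  by apply/measurable_EFinP; apply: measurable_prod_coord; exact: measurable_normal_pdf.
have F0 (x : 'rV[K]_n) : (0 <= (\prod_(i < n) normal_pdf 0 s (x ord0 i))%:E)%E.
  by rewrite lee_fin prodr_ge0// => i _; exact: normal_pdf_ge0.
have cV : (c%:E * lebesgue_rV n (eball r) <= 1)%E.
  rewrite -(integral_prod_coord n (measurable_normal_pdf 0 s))//; last 2 first.
    by move=> t; exact: normal_pdf_ge0.
    exact: integral_normal_pdf.
  rewrite -integral_cst; last exact: measurable_eball.
  apply: (@le_trans _ _ (\int[lebesgue_rV n]_(x in eball r)
      (\prod_(i < n) normal_pdf 0 s (x ord0 i))%:E)%E); last first.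
    by apply: ge0_subset_integral => //; exact: measurable_eball.
  apply: ge0_le_integral => //.
  - exact: measurable_eball.
  - by move=> x _; rewrite lee_fin ltW.
  - exact: measurable_funTS.
  move=> x xr; rewrite lee_fin normal_pdfE// big_split prodr_const card_ord.
  rewrite ler_pM2l ?exprn_gt0// /normal_fun -expR_sum ler_expR.
  under eq_bigr do rewrite subr0.
  rewrite -mulr_suml sumrN mulNr lerN2 s2.
  rewrite (_ : \sum_(i < n) _ = enorm x ^+ 2); last first.
    by rewrite sqr_enorm; apply: eq_bigr => i _; rewrite expr2.
  rewrite ler_pdivrMr ?mulrn_wgt0 ?divr_gt0 ?exprn_gt0//.
  rewrite [leRHS](_ : _ = r ^+ 2); last by field; rewrite gt_eqF.
  by rewrite ler_pXn2r// ?nnegrE ?enorm_ge0 ?ltW.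
rewrite (_ : (_ ^+ n) = c^-1); last first.
  rewrite invfM /normal_peak -exprVn invrK -expRN opprK.
  have -> : expR (n%:R / 2) = Num.sqrt (expR 1) ^+ n :> K.
    rewrite -powR12_sqrt ?expR_ge0// -expRM mul1r -expRM_natl; congr expR; lra.
  rewrite -exprMn; congr (_ ^+ n).
  rewrite s2 -sqrtrM ?mulrn_wge0 ?mulr_ge0 ?pi_ge0 ?divr_ge0 ?sqr_ge0 ?ltW ?invr_gt0//.
  rewrite -[in LHS](ger0_norm (ltW r0)) -sqrtr_sqr -sqrtrM ?sqr_ge0//.
  by congr Num.sqrt; field; rewrite gt_eqF.
by rewrite -[(c^-1)%:E]mule1 lee_pdivlMl.
Qed.

End ball_volume.

(** * Second differences of Lipschitz functions *)

Section second_difference.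
Context {K : realType} {n : nat}.
Implicit Types (F : 'rV[K]_n -> K) (u x y : 'rV[K]_n).

Definition sdiff F u x : K := F (x + u) + F (x - u) - 2 * F x.

Definition lipschitz_ball (r L : K) F : Prop :=
  forall x y, eball r x -> eball r y -> `|F x - F y| <= L * enorm (x - y).

Lemma measurable_sdiff F u : measurable_fun setT F -> measurable_fun setT (sdiff F u).
Proof.
move=> mF; apply: measurable_funB; last first.
  by apply: measurable_funM => //; exact: measurable_cst.
by apply: measurable_funD; apply: (measurableT_comp mF); exact: measurable_translation.
Qed.

Lemma lebesgue_rV_eball_lty (r : K) : (0 < n)%N -> 0 < r ->
  (lebesgue_rV n (eball r) < +oo)%E.
Proof. by move=> n0 r0; apply: le_lt_trans (lebesgue_rV_eball_le n0 r0) (ltry _). Qed.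

(** The bound is quadratic in [u] although [F] is only Lipschitz.  The indicator of
    the ball is replaced by a Lipschitz weight [w] that dominates it.  The second
    difference is the difference of the values of [F (x + u) - F x] at [x] and at
    [x - u], so translation invariance moves the second increment onto [w]: each of
    [F] and [w] contributes one factor [enorm u]. *)
Lemma integral_sdiff_le F u (r L : K) : (0 < n)%N -> 0 < r -> 0 <= L ->
  measurable_fun setT F -> lipschitz_ball (2 * r) L F -> enorm u < r / 2 ->
  (forall x, eball (3 / 2 * r) x -> 0 <= sdiff F u x) ->
  (\int[lebesgue_rV n]_(x in eball r) (sdiff F u x)%:E <=
    (2 / r * L * enorm u ^+ 2)%:E * lebesgue_rV n (eball (2 * r)))%E.
Proof.
move=> n0 r0 L0 mF lF ur sd0; set B := eball (2 * r).
have Boo : (lebesgue_rV n B < +oo)%E by rewrite lebesgue_rV_eball_lty ?mulr_gt0.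
have mB : measurable B by exact: measurable_eball.
(* At least 1 on the ball of radius [r], and 0 off the ball of radius [3 / 2 * r],
   which [u] and [- u] translate into [B]. *)
pose w x := Num.max 0 (3 - 2 / r * enorm x).
pose G x := F (x + u) - F x.
pose A x := w x * G x.
pose H x := w (x + u) * G x.
have mw : measurable_fun setT w.
  apply: measurable_maxr; first exact: measurable_cst.
  apply: measurable_funB; first exact: measurable_cst.
  by apply: measurable_funM; [exact: measurable_cst|exact: measurable_enorm].
have mwu : measurable_fun setT (fun x => w (x + u)).
  by apply: (measurableT_comp mw); exact: measurable_translation.
have mG : measurable_fun setT G.
  apply: measurable_funB => //.
  by apply: (measurableT_comp mF); exact: measurable_translation.
have mA : measurable_fun setT A by exact: measurable_funM.
have mH : measurable_fun setT H by exact: measurable_funM.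
have w0 x : 0 <= w x by rewrite /w le_max lexx.
have w3 x : w x <= 3.
  by rewrite /w ge_max ler0n lerBlDr lerDl mulr_ge0 ?enorm_ge0// divr_ge0// ltW.
have wsupp x : w x != 0 -> eball (3 / 2 * r) x.
  apply: contraNP => /negP; rewrite -leNgt => rx; rewrite /w eq_le ge_max lexx le_max lexx.
  rewrite subr_le0 /= andbT mulrAC ler_pdivlMr//; move: rx; lra.
have wlip x : `|w x - w (x + u)| <= 2 / r * enorm u.
  have k0 : 0 < 2 / r by rewrite divr_gt0.
  have := enorm_distD x u.
  rewrite ler_norml -(ler_pM2l k0) -(ler_pM2l k0 (_ - _)) mulrN mulrBr => /andP[].
  have : 0 <= 2 / r * enorm u by rewrite mulr_ge0 ?enorm_ge0// ltW.
  by rewrite ler_norml /w /Num.max; case: ifP; case: ifP => ? ? ? ? ?; apply/andP; split; lra.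
have inB x : w x != 0 \/ w (x + u) != 0 -> B x /\ B (x + u).
  have := enormD x u; have := enormD (x + u) (- u); rewrite addrK enormN.
  by move=> h1 h2 [] /wsupp; rewrite /B /eball /= => h3; split; lra.
have Gle x : B x -> B (x + u) -> `|G x| <= L * enorm u.
  by move=> Bx Bxu; have := lF _ _ Bxu Bx; rewrite [x + u - x]addrAC subrr add0r.
have Ale x : `|A x| <= 3 * (L * enorm u) * \1_B x.
  have [E|wx] := eqVneq (w x) 0.
    by rewrite /A E mul0r normr0 !mulr_ge0 ?enorm_ge0.
  have [Bx Bxu] := inB x (or_introl wx).
  rewrite normrM indicE mem_set// mulr1 (ger0_norm (w0 x)).
  by apply: ler_pM => //; exact: Gle.
have Hle x : `|H x| <= 3 * (L * enorm u) * \1_B x.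
  have [E|wx] := eqVneq (w (x + u)) 0.
    by rewrite /H E mul0r normr0 !mulr_ge0 ?enorm_ge0.
  have [Bx Bxu] := inB x (or_intror wx).
  rewrite normrM indicE mem_set// mulr1 (ger0_norm (w0 _)).
  by apply: ler_pM => //; exact: Gle.
have AHle x : A x - H x <= 2 / r * L * enorm u ^+ 2 * \1_B x.
  rewrite /A /H -mulrBl.
  have [ww|ww] := pselect (w x != 0 \/ w (x + u) != 0).
    have [Bx Bxu] := inB x ww.
    rewrite indicE mem_set// mulr1.
    rewrite (_ : 2 / r * L * _ = 2 / r * enorm u * (L * enorm u)); last by ring.
    apply: le_trans (ler_norm _) _; rewrite normrM; apply: ler_pM => //.
    exact: Gle.
  have [-> ->] : w x = 0 /\ w (x + u) = 0.
    by split; apply: contrapT => /eqP h; apply: ww; [left|right].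
  rewrite subrr mul0r !mulr_ge0 ?enorm_ge0 ?invr_ge0 ?exprn_ge0 ?enorm_ge0// ltW//.
have iB (c : K) : (lebesgue_rV n).-integrable setT (fun x => (c * \1_B x)%:E).
  under eq_fun do rewrite EFinM; apply: integrableZl => //.
  apply/integrableP; split; first exact/measurable_EFinP.
  rewrite (eq_integral (fun x => (\1_B x)%:E)) => [|x _].
    by rewrite integral_indic// setIT.
  by rewrite gee0_abs// lee_fin.
have iA : (lebesgue_rV n).-integrable setT (EFin \o A).
  apply: le_integrable (iB (3 * (L * enorm u))) => //; first exact/measurable_EFinP.
  by move=> x _; rewrite lee_fin (le_trans (Ale x))// ler_norm.
have iH : (lebesgue_rV n).-integrable setT (EFin \o H).
  apply: le_integrable (iB (3 * (L * enorm u))) => //; first exact/measurable_EFinP.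
  by move=> x _; rewrite lee_fin (le_trans (Hle x))// ler_norm.
have iHu : (lebesgue_rV n).-integrable setT (fun x => (H (x - u))%:E).
  have mHu : measurable_fun setT (fun x => (H (x - u))%:E).
    apply/measurable_EFinP; apply: (measurableT_comp mH); exact: measurable_translation.
  apply/integrableP; split => //.
  rewrite (ge0_integral_translation (- u) (f := fun x => `|(H x)%:E|%E))//.
    by have /integrableP[] := iH.
  by apply: measurableT_comp => //; exact/measurable_EFinP.
have wsd x : A x - H (x - u) = w x * sdiff F u x.
  by rewrite /A /H /G /sdiff subrK; ring.
have msd : measurable_fun setT (fun x => (sdiff F u x)%:E).
  by apply/measurable_EFinP; exact: measurable_sdiff.
have mwsd : measurable_fun setT (fun x => (w x * sdiff F u x)%:E).
  by apply/measurable_EFinP; apply: measurable_funM => //; exact: measurable_sdiff.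
have wsd0 x : 0 <= w x * sdiff F u x.
  have [->|/wsupp wx] := eqVneq (w x) 0; first by rewrite mul0r.
  by rewrite mulr_ge0 ?sd0.
apply: (@le_trans _ _ (\int[lebesgue_rV n]_x (w x * sdiff F u x)%:E)%E).
  apply: (@le_trans _ _ (\int[lebesgue_rV n]_(x in eball r) (w x * sdiff F u x)%:E)%E).
    have sub x : eball r x -> eball (3 / 2 * r) x by rewrite /eball /=; lra.
    apply: ge0_le_integral => //.
    - exact: measurable_eball.
    - by move=> x /sub /sd0; rewrite lee_fin.
    - exact: measurable_funTS.
    - exact: measurable_funTS.
    move=> x xr; rewrite lee_fin ler_peMl ?sd0//; first exact: sub.
    rewrite /w le_max; apply/orP; right; rewrite lerBrDl -lerBrDr.
    by rewrite mulrAC ler_pdivrMr//; move: xr; rewrite /eball /=; lra.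
  apply: ge0_subset_integral => //; first exact: measurable_eball.
  by move=> x _; rewrite lee_fin.
under eq_integral do rewrite -wsd EFinB.
rewrite integralB//.
rewrite (integral_translation (- u) iH) -integralB//.
have -> : ((2 / r * L * enorm u ^+ 2)%:E * lebesgue_rV n B =
    \int[lebesgue_rV n]_x (2 / r * L * enorm u ^+ 2 * \1_B x)%:E)%E.
  under eq_integral do rewrite EFinM.
  rewrite ge0_integralZl_EFin// ?integral_indic ?setIT//.
    exact/measurable_EFinP.
  by rewrite !mulr_ge0 ?invr_ge0 ?exprn_ge0 ?enorm_ge0// ltW.
apply: le_integral => //; first exact: integrableB.
by move=> x _; rewrite -EFinB lee_fin.
Qed.

End second_difference.

(** * Convex functions along lines *)

Section convex_functions.
Context {K : realType} {n : nat}.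
Implicit Types (F : 'rV[K]_n -> K) (u x y e : 'rV[K]_n).

Definition convex_ball (r : K) F : Prop := forall (t : K) x y, 0 <= t <= 1 ->
  eball r x -> eball r y -> F (t *: x + (1 - t) *: y) <= t * F x + (1 - t) * F y.

Lemma econvex_ball (r : K) (f : 'rV[K]_n -> \bar K) : econvex f ->
  (forall x, eball r x -> f x \is a fin_num) -> convex_ball r (fine \o f).
Proof.
move=> cf ff t x y t01 xr yr; have zr := eball_convex t01 xr yr.
by rewrite -lee_fin /= EFinD !EFinM !fineK ?ff//; exact: cf.
Qed.

Let segmentE x u (a : K) : a *: (x + u) + (1 - a) *: x = x + a *: u.
Proof. by apply/rowP => i; rewrite !mxE; ring. Qed.

Section fixed_ball.
Variables (r : K) (F : 'rV[K]_n -> K).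
Hypothesis cF : convex_ball r F.

Lemma sdiff_ge0 x u : eball r (x + u) -> eball r (x - u) -> 0 <= sdiff F u x.
Proof.
move=> xp xm; have h : 0 <= (2^-1 : K) <= 1 by apply/andP; split; lra.
have := cF h xp xm; rewrite (_ : 1 - 2^-1 = 2^-1 :> K); last lra.
rewrite (_ : 2^-1 *: (x + u) + 2^-1 *: (x - u) = x); last first.
  by apply/rowP => i; rewrite !mxE; field.
by rewrite /sdiff; lra.
Qed.

Lemma convex_segment x u a : 0 <= a <= 1 -> eball r x -> eball r (x + u) ->
  F (x + a *: u) - F x <= a * (F (x + u) - F x).
Proof.
move=> a01 xr xur; have := cF a01 xur xr.
rewrite segmentE.
lra.
Qed.

Let q x e (h : K) := h^-1 * (F (h *: e + x) - F x).

Lemma slope_le x e (a h : K) : 0 < a <= 1 -> 0 < h -> eball r x ->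
  eball r (x + h *: e) -> q x e (a * h) <= q x e h.
Proof.
move=> /andP[a0 a1] h0 xr xhr.
have := convex_segment (a := a) _ xr xhr; rewrite a1 ltW// => /(_ isT).
rewrite /q invfM -mulrA ler_pdivrMl// scalerA !(addrC x) => h1.
by rewrite ler_pdivrMl// mulrCA mulVKf// gt_eqF.
Qed.


Lemma slopeN_le x e (a h : K) : 0 < a <= 1 -> 0 < h -> eball r x ->
  eball r (x - h *: e) -> q x e (- h) <= q x e (- (a * h)).
Proof.
move=> a01 h0 xr xhr.
have qN k : q x e (- k) = - q x (- e) k by rewrite /q invrN mulNr scaleNr scalerN.
by rewrite !qN lerN2; apply: slope_le => //; rewrite scalerN.
Qed.

Lemma slope_sdiff x e (h : K) : h != 0 -> q x e h - q x e (- h) = sdiff F (h *: e) x / h.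
Proof. by move=> h0; rewrite /q /sdiff invrN !(addrC x) scaleNr; field. Qed.

(** The difference quotients at [- h] and at [h] enclose those at smaller steps, and
    their gap is the second difference divided by [h]. *)
Lemma derivable_sdiff x e : eball r x ->
  (forall eps : K, 0 < eps -> exists h : K, [/\ 0 < h, eball r (x + h *: e),
     eball r (x - h *: e) & sdiff F (h *: e) x < eps * h]) ->
  derivable F x e.
Proof.
move=> xr small.
have scaled (k h : K) : 0 < k <= h -> 0 < k / h <= 1 /\ k / h * h = k.
  move=> /andP[k0 kh]; have h0 := lt_le_trans k0 kh.
  split; last by rewrite divfK// gt_eqF.
  by apply/andP; split; [exact: divr_gt0|rewrite ler_pdivrMr// mul1r].
have qle k h : 0 < k <= h -> eball r (x + h *: e) -> q x e k <= q x e h.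
  move=> kh xh; have [k1 {1}<-] := scaled _ _ kh; apply: slope_le => //.
  by move: kh => /andP[]; exact: lt_le_trans.
have qNle k h : 0 < k <= h -> eball r (x - h *: e) -> q x e (- h) <= q x e (- k).
  move=> kh xh; have [k1 {1}<-] := scaled _ _ kh; apply: slopeN_le => //.
  by move: kh => /andP[]; exact: lt_le_trans.
have inr k h : 0 < k <= h -> eball r (x + h *: e) -> eball r (x + k *: e).
  move=> kh xh; have [/andP[k0 k1] {1}<-] := scaled _ _ kh.
  have := eball_convex (t := k / h) _ xh xr; rewrite k1 ltW// => /(_ isT).
  by rewrite segmentE scalerA.
have inNr k h : 0 < k <= h -> eball r (x - h *: e) -> eball r (x - k *: e).
  move=> kh xh; have [/andP[k0 k1] {1}<-] := scaled _ _ kh.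
  have := eball_convex (t := k / h) _ xh xr; rewrite k1 ltW// => /(_ isT).
  by rewrite segmentE scalerN scalerA.
have [h0 [h00 h0r h0Nr _]] := small 1 ltr01.
pose S := [set q x e h | h in [set h : K | 0 < h <= h0]].
have qNq k h : 0 < k <= h0 -> 0 < h <= h0 -> q x e (- k) <= q x e h.
  move=> kh0 hh0; pose m := Num.min k h.
  have m0 : 0 < m by rewrite lt_min; move: kh0 hh0 => /andP[->] _ /andP[->].
  have mk : 0 < m <= k by rewrite m0 ge_min lexx.
  have mh : 0 < m <= h by rewrite m0 ge_min lexx orbT.
  apply: le_trans (qNle _ _ mk (inNr _ _ kh0 h0Nr)) _.
  apply: le_trans (qle _ _ mh (inr _ _ hh0 h0r)).
  rewrite -subr_ge0 slope_sdiff ?gt_eqF// divr_ge0 ?(ltW m0)//.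
  have mh0 : 0 < m <= h0 by rewrite m0 (le_trans _ (andP hh0).2)//; have /andP[] := mh.
  by apply: sdiff_ge0; [exact: inr mh0 _|exact: inNr mh0 _].
have S0 : S !=set0 by exists (q x e h0), h0 => //=; rewrite h00 lexx.
have infS h : 0 < h <= h0 -> q x e (- h) <= inf S <= q x e h.
  move=> hh0; apply/andP; split.
    by apply: lb_le_inf => // _ [k kh0 <-]; exact: qNq.
  apply: ge_inf; last by exists h.
  by exists (q x e (- h)) => _ [k kh0 <-]; exact: qNq.
apply/cvg_ex; exists (inf S); apply/cvgrPdist_le => /= eps eps0.
have [h1 [h10 h1r h1Nr h1s]] := small _ eps0.
pose h := Num.min h0 h1.
have h_gt0 : 0 < h by rewrite lt_min h00.
have hh0 : 0 < h <= h0 by rewrite h_gt0 ge_min lexx.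
have hh1 : 0 < h <= h1 by rewrite h_gt0 ge_min lexx orbT.
have gap : q x e h - q x e (- h) <= eps.
  apply: (@le_trans _ _ (q x e h1 - q x e (- h1))).
    by apply: lerB; [exact: qle|exact: qNle].
  by rewrite slope_sdiff ?gt_eqF// ler_pdivrMr// ltW.
have /andP[l1 l2] := infS _ hh0.
near=> k.
have k0 : k != 0 by near: k; exact: nbhs_dnbhs_neq.
have kh : `|k| <= h.
  by near: k; exact: dnbhs0_le.
rewrite -[X in `|_ - X|]/(q x e k).
have kh' : 0 < `|k| <= h by rewrite normr_gt0 k0.
have kh0 : 0 < `|k| <= h0 by rewrite normr_gt0 k0 (le_trans kh)//; case/andP : hh0.
have qb : q x e (- h) <= q x e k <= q x e h.
  have hN := inNr _ _ hh0 h0Nr; have hp := inr _ _ hh0 h0r.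
  have a1 := qNle _ _ kh' hN; have a2 := qle _ _ kh' hp.
  have a3 : q x e (- `|k|) <= q x e `|k| by exact: qNq.
  have [kp|kn] := ltP 0 k.
    by rewrite -(gtr0_norm kp) a2 andbT (le_trans a1).
  by rewrite -[k]opprK -(ler0_norm kn) a1 (le_trans a3).
move: qb => /andP[b1 b2]; rewrite ler_norml; apply/andP; split; lra.
Unshelve. all: by end_near. Qed.

(** Difference quotients are monotone in the step: the one at [s] is compared with
    those at [a * s], for [a] small. *)
Lemma derive_le x e (s : K) : eball r x -> eball r (x + s *: e) ->
  derivable F x e -> s * 'D_e F x <= F (x + s *: e) - F x.
Proof.
move=> xr xs dF.
have [->|s0] := eqVneq s 0; first by rewrite mul0r scale0r addr0 subrr.
have cq : q x e k @[k --> 0^'] --> 'D_e F x by exact: dF.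
have near0 eps : 0 < eps -> exists a : K,
    0 < a <= 1 /\ `|'D_e F x - q x e (a * s)| <= eps.
  move=> eps0; have /cvgrPdist_le/(_ _ eps0)/nbhs_ballP[del /= del0 hd] := cq.
  have s0' : 0 < `|s| by rewrite normr_gt0.
  pose a := Num.min 1 (del / 2 / `|s|).
  have a0 : 0 < a by rewrite lt_min ltr01 !divr_gt0.
  exists a; split; first by rewrite a0 ge_min lexx.
  apply: hd; last by rewrite mulf_neq0// gt_eqF.
  rewrite /ball /= sub0r normrN normrM gtr0_norm// -ltr_pdivlMr//.
  by rewrite gt_min ltr_pM2r ?invr_gt0//; apply/orP; right; lra.
have sq : F (x + s *: e) - F x = s * q x e s by rewrite /q mulVKf// (addrC x).
rewrite sq; have [sp|sn] := ltP 0 s.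
  rewrite ler_pM2l//; apply/ler_addgt0Pr => eps /near0[a [a01]].
  have := slope_le a01 sp xr xs; rewrite ler_distl => h1 /andP[_]; lra.
have {}sn : s < 0 by rewrite lt_neqAle s0.
rewrite ler_nM2l//; apply/ler_addgt0Pr => eps /near0[a [a01]].
have := @slopeN_le x e a (- s) a01; rewrite oppr_gt0 mulrN !opprK scaleNr opprK => /(_ sn xr xs).
rewrite ler_distl => h1 /andP[h2 _]; lra.
Qed.

End fixed_ball.
End convex_functions.

(** * Bounded densities and almost everywhere derivability *)

Section density.
Context d (T : measurableType d) {K : realType}.
Variables (mu lam : {measure set T -> \bar K}) (M : K).
Hypothesis M0 : 0 <= M.
Hypothesis muM : forall A, measurable A -> (mu A <= M%:E * lam A)%E.

Lemma ge0_integral_density_le (D : set T) (f : T -> \bar K) : measurable D ->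
  measurable_fun D f -> (forall x, D x -> 0 <= f x)%E ->
  (\int[mu]_(x in D) f x <= M%:E * \int[lam]_(x in D) f x)%E.
Proof.
move=> mD mf f0; pose k : {nonneg K} := NngNum M0.
rewrite -[M]/(k%:num) -ge0_integral_mscale//.
rewrite integral_mkcond [leRHS]integral_mkcond.
apply: ge0_le_measure_integral => //.
- exact: erestrict_ge0.
- exact/(measurable_restrictT _ _).1.
Qed.

End density.

Section integral_monotone.
Context d (T : measurableType d) {K : realType}.
Variable mu : {measure set T -> \bar K}.
Import HBNNSimple.

(** The integral of a nonnegative function is a supremum over the simple functions
    below it, so it is monotone even where it is only a lower integral. *)
Lemma ge0_le_lower_integral (f g : T -> \bar K) :
  (forall x, 0 <= f x)%E -> (forall x, f x <= g x)%E ->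
  (\int[mu]_x f x <= \int[mu]_x g x)%E.
Proof.
move=> f0 fg; have g0 x : (0 <= g x)%E := le_trans (f0 x) (fg x).
rewrite !ge0_integralTE//; apply: le_ereal_sup => _ [h hf <-].
by exists h => // x; exact: le_trans (hf x) (fg x).
Qed.

(** Setting [g] to [+oo] on a null set turns the almost everywhere inequality into a
    pointwise one.  The function [f] will be a norm of gradients, which take default
    values where derivatives do not exist. *)
Lemma ge0_negligible_le_integral (f g : T -> \bar K) (N : set T) :
  mu.-negligible N -> measurable_fun setT g -> (forall x, 0 <= f x)%E ->
  (forall x, 0 <= g x)%E -> (forall x, ~ N x -> f x <= g x)%E ->
  (\int[mu]_x f x <= \int[mu]_x g x)%E.
Proof.
move=> [N' [mN' N'0 NN']] mg f0 g0 fg.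
pose h x := maxe (g x) (((cst +oo) \_ N') x)%E.
have hN x : N' x -> h x = +oo%E.
  by move=> N'x; rewrite /h patchE mem_set//=; apply/max_idPr; exact: leey.
have hNN x : ~ N' x -> h x = g x.
  by move=> N'x; rewrite /h patchE memNset//; exact/max_idPl.
have mh : measurable_fun setT h.
  by apply: measurable_maxe => //; exact/(measurable_restrictT _ _).1.
have -> : (\int[mu]_x g x = \int[mu]_x h x)%E.
  apply: ge0_ae_eq_integral => //.
  - by move=> x _; rewrite /h le_max g0.
  exists N'; split => // x /= /not_implyP[_ gh].
  by apply: contrapT => /hNN h'; apply: gh; rewrite h'.
apply: ge0_le_lower_integral => // x.
have [N'x|N'x] := pselect (N' x); first by rewrite hN// leey.
by rewrite hNN//; apply: fg => Nx; exact/N'x/NN'.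
Qed.

End integral_monotone.

Section ae_derivable.
Context {K : realType} {n : nat}.

(** A convex function has one-sided derivatives; at a point where they differ, the
    second difference at every step [t] is at least a fixed multiple of [t].  Its
    integral being of order [t ^+ 2], Markov's inequality gives such a set of points a
    measure of order [t], hence 0. *)
Lemma negligible_not_derivable (mu : {measure set 'rV[K]_n -> \bar K}) (r c : K)
    (F : 'rV[K]_n -> K) (i : 'I_n) : 0 < r -> 0 <= c ->
  convex_ball (2 * r) F -> measurable_fun setT F ->
  (forall t, 0 < t < r / 2 ->
    (\int[mu]_(x in eball r) (sdiff F (t *: delta_mx ord0 i) x)%:E <= (c * t ^+ 2)%:E)%E) ->
  mu.-negligible [set x | eball r x /\ ~ derivable F x (delta_mx ord0 i)].
Proof.
move=> r0 c0 cF mF sdF; pose e : 'rV[K]_n := delta_mx ord0 i.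
pose t m : K := r / 4 / m.+1%:R.
have t_gt0 m : 0 < t m by rewrite !divr_gt0.
have t_lt m : t m < r / 2.
  rewrite ltr_pdivrMr//; have : 1 <= m.+1%:R :> K by rewrite ler1n.
  nra.
have inB x s : eball r x -> `|s| < r / 2 -> eball (2 * r) (x + s *: e).
  have := enormD x (s *: e); rewrite enorm_delta /eball /= => h1 h2 h3; lra.
have sd0 x m : eball r x -> 0 <= sdiff F (t m *: e) x.
  move=> xr; apply: (sdiff_ge0 cF); first by apply: inB; rewrite ?gtr0_norm.
  by rewrite -scaleNr; apply: inB; rewrite ?normrN ?gtr0_norm.
pose S k m := [set x | eball r x /\ t m / k.+1%:R <= sdiff F (t m *: e) x].
pose N k := \bigcap_m S k m.
have mS k m : measurable (S k m).
  have := @measurable_fun_ler _ _ _ setT _ _ (measurable_cst (t m / k.+1%:R))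
     (measurable_sdiff (t m *: e) mF) measurableT [set true].
  rewrite setTI => mle.
  exact: (measurableI _ _ (measurable_eball r) (mle I)).
have muS k m : (mu (S k m) <= (c * k.+1%:R * t m)%:E)%E.
  have a0 : 0 < t m / k.+1%:R by rewrite divr_gt0.
  suff : ((t m / k.+1%:R)%:E * mu (S k m) <= (c * t m ^+ 2)%:E)%E.
    rewrite -lee_pdivlMl// -EFinM => /le_trans; apply; rewrite lee_fin.
    have : k.+1%:R != 0 :> K by rewrite pnatr_eq0.
    have : t m != 0 by rewrite gt_eqF.
    move: (t m) (k.+1%:R : K) => a b ha hb.
    suff -> : (a / b)^-1 * (c * a ^+ 2) = c * b * a by []. 
    by field; rewrite ha hb.
  rewrite -integral_cst//; apply: le_trans (sdF (t m) _); last by rewrite t_gt0 t_lt.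
  apply: (@le_trans _ _ (\int[mu]_(x in S k m) (sdiff F (t m *: e) x)%:E)%E).
    apply: ge0_le_integral => //.
    - by move=> x _; rewrite lee_fin ltW.
    - by apply: measurable_funTS; apply/measurable_EFinP; exact: measurable_sdiff.
    - by move=> x [_]; rewrite lee_fin.
  apply: ge0_subset_integral => //.
  - exact: measurable_eball.
  - by apply: measurable_funTS; apply/measurable_EFinP; exact: measurable_sdiff.
  - by move=> x xr; rewrite lee_fin; exact: sd0.
  - by move=> x [].
have muN k : mu.-negligible (N k).
  exists (N k); split => //; first by apply: bigcapT_measurable => m; exact: mS.
  apply/eqP; rewrite eq_le measure_ge0 andbT; apply/lee_addgt0Pr => eps eps0.
  rewrite add0e; pose C := c * k.+1%:R * (r / 4) / eps.
  have [m Cm] : exists m, C < m.+1%:R.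
    exists (Num.truncn C); exact: truncnS_gt.
  apply: (@le_trans _ _ (mu (S k m))).
    apply: le_measure; rewrite ?inE//; first by apply: bigcapT_measurable => ?; exact: mS.
    exact: bigcap_inf.
  apply: (le_trans (muS k m)); rewrite lee_fin /t mulrA ler_pdivrMr//.
  by move: Cm; rewrite /C ltr_pdivrMr// [X in _ < X]mulrC => /ltW.
apply: negligibleS (negligible_bigcup muN) => x [xr nd].
apply: contrapT => xN; apply: nd; apply: (derivable_sdiff cF).
  by move: xr; rewrite /eball /=; lra.
move=> eps eps0; have [k ek] : exists k : nat, eps^-1 < k.+1%:R.
  by exists (Num.truncn eps^-1); exact: truncnS_gt.
have : ~ N k x by move=> Nx; apply: xN; exists k.
rewrite /N /S /bigcap /= -existsNE => -[m /not_implyP[_ /not_andP[//|/negP]]].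
rewrite -ltNge => sk; exists (t m); split => //.
- by apply: inB => //; rewrite gtr0_norm.
- by rewrite -scaleNr; apply: inB; rewrite ?normrN ?gtr0_norm.
apply: lt_trans sk _; rewrite mulrC ltr_pM2r//.
by rewrite invf_plt ?posrE.
Qed.

End ae_derivable.

(** * Supports *)

Section support.
Context {K : realType} {n : nat}.
Variable mu : {measure set 'rV[K]_n -> \bar K}.

(** Every point outside the support has a null rational box around it, and there
    are countably many rational boxes. *)
Lemma negligible_setC_msupport : mu.-negligible (~` msupport mu).
Proof.
pose box (ab : 'rV[rat]_n * 'rV[rat]_n) := [set v : 'rV[K]_n |
  forall i j, ratr (ab.1 i j) < v i j < ratr (ab.2 i j)].
pose F k := if unpickle k is Some ab then
  if `[< mu.-negligible (box ab) >] then box ab else set0 else set0.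
have F0 k : mu.-negligible (F k).
  rewrite /F; case: unpickle => [ab|]; last exact: negligible_set0.
  by case: asboolP => // _; exact: negligible_set0.
apply: negligibleS (negligible_bigcup F0) => x.
move=> /existsNP[U /not_implyP[oU /not_implyP[Ux /negP]]]; rewrite -leNgt => U0.
have [a [b [abU xab]]] := rational_box oU Ux.
exists (pickle (a, b)) => //; rewrite /F pickleK; case: asboolP => // -[].
exists U; split => //; first exact: open_measurable_mx.
by apply/eqP; rewrite eq_le U0 measure_ge0.
Qed.

Lemma negligible_integral_ball (r : K) (f : 'rV[K]_n -> \bar K) :
  msupport mu `<=` eball r -> measurable_fun setT f ->
  (\int[mu]_x f x = \int[mu]_(x in eball r) f x)%E.
Proof.
move=> sr mf; have [N [mN N0 rN]] := negligible_setC_msupport.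
rewrite [RHS]integral_mkcond; apply: ae_eq_integral => //.
  by apply/(measurable_restrictT _ _).1; [exact: measurable_eball|exact: measurable_funTS].
exists N; split => // x /= /not_implyP[_ fx]; apply: rN => /sr xr.
by apply: fx; rewrite patchE mem_set.
Qed.

End support.

(** * Conjugates *)

Section conjugates.
Context {K : realType} {n : nat}.
Implicit Types (f psi : 'rV[K]_n -> \bar K) (x y v : 'rV[K]_n).

Lemma conjugate_ge f x y : ((dotp x y)%:E - f x <= conjugate f y)%E.
Proof. by apply: ereal_sup_ubound; exists x. Qed.

Lemma conjugate_neNy f x y : f x != +oo%E -> conjugate f y != -oo%E.
Proof.
move=> fx; rewrite -ltNye; apply: lt_le_trans (conjugate_ge f x y).
by case: (f x) fx => [c| |]//= _; rewrite ?ltNyr ?ltNyy.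
Qed.

Lemma dotp_continuous x : continuous (dotp x).
Proof.
apply: continuous_big => [|i _ y]; first exact: add_continuous.
apply: (@continuousM K); [exact: cst_continuous|exact: coord_continuous].
Qed.

Lemma conjugate_lsc f : lower_semicontinuous (conjugate f).
Proof.
move=> y a /ereal_sup_gt[_ [x _ <-] ax].
exists [set z | (a%:E < (dotp x z)%:E - f x)%E]; last first.
  by move=> z /= az; apply: lt_le_trans az (conjugate_ge _ _ _).
case: (f x) ax => [c| |] /= ax; last 2 first.
- by [].
- by apply: filterS filterT => z _ /=; exact: ltry.
apply: (@filterS _ _ _ (dotp x @^-1` [set t | a + c < t])) => [z /=|].
  by rewrite -ltrBrDr -EFinB lte_fin.
apply: open_nbhs_nbhs; split; last by rewrite /= -ltrBrDr -lte_fin EFinB.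
by apply: open_comp => [z _|]; [exact: dotp_continuous|exact: open_gt].
Qed.

Lemma conjugate_convex f : (forall x, f x != -oo%E) -> econvex (conjugate f).
Proof.
move=> fNy t y z /andP[t0 t1]; apply: ge_ereal_sup => _ [x _ <-].
have := fNy x; have := conjugate_ge f x y; have := conjugate_ge f x z.
case: (f x) => [c| |]//= hz hy _; last by rewrite leNye.
apply: le_trans (leeD (lee_wpmul2l _ hy) (lee_wpmul2l _ hz)); rewrite ?lee_fin ?subr_ge0//.
by rewrite dotpDr !dotpZr; lra.
Qed.

Lemma Gamma0_conjugate f x y : (forall x, f x != -oo%E) -> f x != +oo%E ->
  conjugate f y != +oo%E -> Gamma0 (conjugate f).
Proof.
move=> fNy fx fy; split; first by move=> z; exact: conjugate_neNy fx.
- by exists y.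
- exact: conjugate_lsc.
- exact: conjugate_convex.
Qed.

Lemma conjugate_conjugate_le f y : f y != -oo%E -> (conjugate (conjugate f) y <= f y)%E.
Proof.
move=> fy; apply: ge_ereal_sup => _ [x _ <-].
have := conjugate_ge f y x; rewrite dotpC.
case: (f y) fy => [c| |]// _ => [|_]; last exact: leey.
case: (conjugate f x) => [b| |]//=; last by move=> _; exact: leNye.
by rewrite -!EFinB !lee_fin; lra.
Qed.

Section half_sum.
Variables f g : 'rV[K]_n -> \bar K.

(** The conjugate of the infimal convolution
    [x |-> inf_v (f (x - v) + g (x + v)) / 2]. *)
Definition half_conjugates y : \bar K :=
  (2^-1%:E * (conjugate f y + conjugate g y))%E.

Lemma conjugate_half_le x v : f (x - v) \is a fin_num -> g (x + v) \is a fin_num ->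
  (conjugate half_conjugates x <= 2^-1%:E * (f (x - v) + g (x + v)))%E.
Proof.
move=> ff fg; apply: ge_ereal_sup => _ [y _ <-]; rewrite /half_conjugates.
have := conjugate_ge f (x - v) y; have := conjugate_ge g (x + v) y.
move: ff fg; case: (f (x - v)) => [a| |]//; case: (g (x + v)) => [b| |]// _ _.
rewrite -scaleN1r !dotpDl dotpZl.
case: (conjugate f y) => [c| |]//; case: (conjugate g y) => [e| |]//; last 3 first.
- by rewrite addey// gt0_muley ?lte_fin// leNye.
- by rewrite addye// gt0_muley ?lte_fin// leNye.
- by rewrite addye// gt0_muley ?lte_fin// leNye.
rewrite !lee_fin [dotp y x]dotpC; lra.
Qed.

End half_sum.

End conjugates.

(** * The Kantorovich gap *)

Section integrability.
Context d (T : measurableType d) {K : realType} (mu : {finite_measure set T -> \bar K}).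
Implicit Types (D : set T) (h : T -> \bar K).
Local Open Scope ereal_scope.

Lemma bounded_integrable D h (c : K) : measurable D -> measurable_fun D h ->
  (forall x, D x -> `|h x| <= c%:E) -> mu.-integrable D h.
Proof.
move=> mD mh hc; apply: (le_integrable mD mh) (finite_measure_integrable_cst mu c mD).
by move=> x Dx; rewrite (le_trans (hc x Dx))// lee_fin ler_norm.
Qed.

Lemma lower_bounded_integrable D h (c : K) : measurable D -> measurable_fun D h ->
  (forall x, D x -> c%:E <= h x) -> \int[mu]_(x in D) h x < +oo -> mu.-integrable D h.
Proof.
move=> mD mh hc hoo; apply/integrableP; split => //.
have mhp : measurable_fun D h^\+ by exact: measurable_funepos.
have mhn : measurable_fun D h^\- by exact: measurable_funeneg.
have hn : \int[mu]_(x in D) h^\- x < +oo.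
  apply: (@le_lt_trans _ _ (\int[mu]_(x in D) (cst `|c|%:E) x)).
    apply: ge0_le_integral => // x Dx; rewrite funenegE ge_max lee_fin normr_ge0 andbT.
    rewrite leeNl (le_trans _ (hc x Dx))// -EFinN lee_fin.
    by rewrite lerNl -normrN ler_norm.
  rewrite integral_cst// lte_mul_pinfty// -ge0_fin_numE//.
  exact: fin_num_measure.
have hp : \int[mu]_(x in D) h^\+ x < +oo.
  move: hoo; rewrite integralE.
  have : 0 <= \int[mu]_(x in D) h^\- x by apply: integral_ge0 => x _; exact: funeneg_ge0.
  move: hn; move: (\int[mu]_(x in D) h^\+ x) (\int[mu]_(x in D) h^\- x) => a b.
  by case: a => [a| |]; case: b => [b| |]//= *; exact: ltry.
rewrite (_ : (fun x => _) = h^\+ \+ h^\-); last by rewrite -fune_abse.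
by rewrite ge0_integralD// lte_add_pinfty.
Qed.

End integrability.

Section gap.
Context {K : realType} {n : nat}.
Variables (mu nu : probability 'rV[K]_n K) (r : K).
Hypothesis r0 : 0 < r.
Hypothesis mur : msupport mu `<=` eball r.
Hypothesis nur : msupport nu `<=` eball r.
Variables (F f : 'rV[K]_n -> \bar K).
Variables (LF Lf Lc : K).
Hypothesis lipF : elipschitz_on (eball (2 * r)) LF F.
Hypothesis lipf : elipschitz_on (eball (2 * r)) Lf f.
Hypothesis lipc : elipschitz_on (eball (2 * r)) Lc (conjugate f).

Let B : set 'rV[K]_n := eball r.
Let mB : measurable B. Proof. exact: measurable_eball. Qed.

Let in2B x : B x -> eball (2 * r) x.
Proof. by rewrite /B /eball /=; have := enorm_ge0 x; lra. Qed.

Lemma elipschitz_bounded (L : K) (h : 'rV[K]_n -> \bar K) :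
  elipschitz_on (eball (2 * r)) L h -> exists c : K, forall x, B x -> (`|h x| <= c%:E)%E.
Proof.
move=> [hfin hL]; have B0 : B 0 by rewrite /B /eball /= enorm0.
exists (`|fine (h 0)| + `|L| * r) => x Bx.
have := hL x 0 (in2B Bx) (in2B B0); rewrite subr0.
have := hfin _ (in2B Bx); have := hfin _ (in2B B0).
case: (h x) => [a| |]//; case: (h 0) => [b| |]// _ _.
rewrite -EFinB !abse_EFin !lee_fin /= => ab.
have : L * enorm x <= `|L| * r.
  rewrite (le_trans (ler_wpM2r (enorm_ge0 x) (ler_norm L)))// ler_wpM2l//.
  exact: ltW.
have := ler_normD (a - b) b; rewrite subrK; lra.
Qed.

Lemma probability_eball (P : probability 'rV[K]_n K) :
  msupport P `<=` B -> P B = 1%E.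
Proof.
move=> sP; have [N [mN N0 sN]] := negligible_setC_msupport P.
apply/eqP; rewrite eq_le probability_le1//=.
rewrite -(probability_setT P) (_ : setT = B `|` N); last first.
  apply/esym/seteqP; split => // x _.
  by have [Bx|Bx] := pselect (B x); [left|right; apply: sN => /sP].
by apply: (le_trans (measureU2 P mB mN)); rewrite [X in (_ + X)%E]N0 adde0.
Qed.

(** The function [P] is [F + f - 2 * g], where [g] is the conjugate of
    [half_conjugates F f].  Since [conjugate g] is at most [half_conjugates F f], the
    minimality of [F] tested against [g] bounds the integral of [P] by the gap.  Since
    [g x] is at most the mean of [F (x - v)] and [f (x + v)], the same [P] serves for
    all [v] at once, and no measurable choice of [v] has to be made. *)
Lemma kantorovich_gap : brenier_potential mu nu F -> Gamma0 f ->
  exists (delta : K) (P : 'rV[K]_n -> K),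
  [/\ (kantorovich mu nu f - kantorovich mu nu F = delta%:E)%E,
      measurable_fun setT P,
      forall x v, B x -> enorm v < r ->
        fine (F x) - fine (F (x - v)) + (fine (f x) - fine (f (x + v))) <= P x &
      (\int[mu]_(x in B) (P x)%:E <= delta%:E)%E].
Proof.
move=> [[FNy [x0 Fx0] lscF cF] optF] [fNy [z0 fz0] lscf cf].
pose psi := half_conjugates F f; pose g := conjugate psi.
have mF := lsc_measurable lscF; have mf := lsc_measurable lscf.
have mcF := lsc_measurable (@conjugate_lsc _ _ F).
have mcf := lsc_measurable (@conjugate_lsc _ _ f).
have mg := lsc_measurable (@conjugate_lsc _ _ psi).
have mcg := lsc_measurable (@conjugate_lsc _ _ g).
have B0 : B 0 by rewrite /B /eball /= enorm0.
have cFNy y : conjugate F y != -oo%E := conjugate_neNy y Fx0.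
have cfNy y : conjugate f y != -oo%E := conjugate_neNy y fz0.
have psiNy y : psi y != -oo%E.
  rewrite /psi /half_conjugates; have := cFNy y; have := cfNy y.
  case: (conjugate F y) => [a| |]//; case: (conjugate f y) => [b| |]//= _ _;
    by rewrite ?addye ?addey// gt0_muley// lte_fin.
have [bF Fb] := elipschitz_bounded lipF.
have [bf fb] := elipschitz_bounded lipf.
have [bc cb] := elipschitz_bounded lipc.
have iF : mu.-integrable B F by apply: bounded_integrable Fb => //; exact: measurable_funTS.
have if_ : mu.-integrable B f by apply: bounded_integrable fb => //; exact: measurable_funTS.
have ic : nu.-integrable B (conjugate f).
  by apply: bounded_integrable cb => //; exact: measurable_funTS.
have kE h : measurable_fun setT h -> measurable_fun setT (conjugate h) ->
    (kantorovich mu nu h = \int[mu]_(x in B) h x + \int[nu]_(y in B) conjugate h y)%E.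
  move=> mh mch; congr (_ + _)%E; exact: negligible_integral_ball.
have fin_F0 : F 0 \is a fin_num := lipF.1 _ (in2B B0).
have cFge y : (- F 0 <= conjugate F y)%E.
  by have := conjugate_ge F 0 y; rewrite -(scale0r (0 : 'rV[K]_n)) dotpZl mul0r scale0r add0e.
have icF : nu.-integrable B (conjugate F).
  apply: (@lower_bounded_integrable _ _ _ _ _ _ (fine (- F 0)%E)) => //.
  - exact: measurable_funTS.
  - by move=> y _; rewrite fineK ?fin_numN.
  have : (kantorovich mu nu F < +oo)%E.
    rewrite optF; apply: (@le_lt_trans _ _ (kantorovich mu nu f)).
      by apply: ereal_inf_lbound; exists f => //; split => //; exists z0.
    rewrite kE// -(fineK (integrable_fin_num mB if_)) -(fineK (integrable_fin_num mB ic)).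
    exact: ltry.
  rewrite kE// -(fineK (integrable_fin_num mB iF)).
  by case: (\int[nu]_(y in B) conjugate F y)%E => [a| |] _ //; exact: ltry.
have [y0 By0 cFy0] : exists2 y, B y & conjugate F y != +oo%E.
  apply: contrapT => /forall2NP noy.
  have := integrable_fin_num mB icF.
  rewrite (eq_integral (cst +oo%E)) => [|y]; last first.
    by rewrite inE => By; have [//|/negP] := noy y; rewrite negbK => /eqP.
  by rewrite integral_cst// [X in (_ * X)%E](probability_eball nur) mule1.
have psiy0 : psi y0 \is a fin_num.
  rewrite /psi /half_conjugates fin_numM// fin_numD lipc.1 ?andbT; last exact: in2B.
  by rewrite fin_numE cFNy.
have gle x v : eball (2 * r) (x - v) -> eball (2 * r) (x + v) ->
    (g x <= 2^-1%:E * (F (x - v)%R + f (x + v)%R))%E.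
  by move=> /lipF.1 Fv /lipf.1 fv; exact: conjugate_half_le.
have gB x : B x -> (g x <= 2^-1%:E * (F x + f x))%E.
  by move=> Bx; have := @gle x 0; rewrite subr0 addr0; apply; exact: in2B.
have gfin x : B x -> g x \is a fin_num.
  move=> Bx; rewrite fin_numE (@conjugate_neNy _ _ psi y0)/=; last first.
    by case: (psi y0) psiy0.
  have := gB x Bx; have := lipF.1 _ (in2B Bx); have := lipf.1 _ (in2B Bx).
  by case: (F x) => // a; case: (f x) => // b; case: (g x).
have Gg : Gamma0 g.
  apply: (@Gamma0_conjugate _ _ psi y0 0) => //; first by case: (psi y0) psiy0.
  by have := gfin 0 B0; rewrite /g; case: conjugate.
have ig : mu.-integrable B g.
  apply: (@bounded_integrable _ _ _ _ _ _ (bF + bf + (r * enorm y0 + `|fine (psi y0)|))) => //.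
    exact: measurable_funTS.
  move=> x Bx; have := gB x Bx; have := Fb x Bx; have := fb x Bx.
  have := conjugate_ge psi y0 x; rewrite -/g; have := gfin x Bx.
  have := lipF.1 _ (in2B Bx); have := lipf.1 _ (in2B Bx).
  case: (psi y0) psiy0 => // p _; case: (F x) => // a _; case: (f x) => // b _.
  case: (g x) => // c _; rewrite -!EFinB -EFinD -EFinM !abse_EFin !lee_fin /=.
  have : `|dotp y0 x| <= r * enorm y0.
    rewrite ler_norml; apply/andP; split.
      rewrite lerNl; have := dotp_le (- y0) x; rewrite enormN -scaleN1r dotpZl mulN1r.
      move=> /le_trans; apply; rewrite mulrC ler_wpM2r ?enorm_ge0//; exact: ltW.
    apply: le_trans (dotp_le _ _) _; rewrite mulrC ler_wpM2r ?enorm_ge0//; exact: ltW.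
  rewrite !ler_norml => /andP[? ?] ? /andP[? ?] /andP[? ?] ?.
  have := ler_norm p; have := ler_norm (- p); rewrite normrN => ? ?.
  by apply/andP; split; lra.
have ipsi : nu.-integrable B psi.
  by apply: integrableZl => //; exact: integrableD.
have cgle y : (conjugate g y <= psi y)%E by exact: conjugate_conjugate_le.
have g0fin := gfin 0 B0.
have cgge y : (- g 0%R <= conjugate g y)%E.
  by have := conjugate_ge g 0 y; rewrite -(scale0r (0 : 'rV[K]_n)) dotpZl mul0r scale0r add0e.
have cgint : (\int[nu]_(y in B) conjugate g y <= \int[nu]_(y in B) psi y)%E.
  apply: le_integral => //.
  apply: (@le_integrable _ _ _ _ _ mB _ (fun y : 'rV[K]_n => `|psi y| + `|g 0%R|)%E).
  - exact: measurable_funTS.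
  - move=> y By; move: g0fin (cgle y) (cgge y) (psiNy y).
    case: (g 0) => // a _ h2 h1 pn; rewrite [leRHS]gee0_abs ?adde_ge0//; move: h1 h2 pn.
    case: (psi y) => [b| |] // h1 h2 _; last by rewrite addye ?leey.
    move: h1 h2; case: (conjugate g y) => // c; rewrite -EFinN -EFinD !lee_fin => h1 h2.
    rewrite ler_norml; have := ler_norm a; have := ler_norm b; have := normr_ge0 b.
    have := normr_ge0 a; have := ler_norm (- b); rewrite normrN => *.
    by apply/andP; split; lra.
  - apply: integrableD => //; first exact: integrable_abse.
    by move: g0fin; case: (g 0) => // a _; exact: finite_measure_integrable_cst.
pose P x := fine (F x) + fine (f x) - 2 * fine (g x).
have FE x : B x -> F x = (fine (F x))%:E by move=> Bx; rewrite fineK// lipF.1//; exact: in2B.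
have fE x : B x -> f x = (fine (f x))%:E by move=> Bx; rewrite fineK// lipf.1//; exact: in2B.
have gE x : B x -> g x = (fine (g x))%:E by move=> Bx; rewrite fineK// gfin.
have mfine h : measurable_fun setT h -> measurable_fun setT (fun x : 'rV[K]_n => fine (h x)).
  move=> mh; exact: measurableT_comp.
pose IF := fine (\int[mu]_(x in B) F x)%E; pose If := fine (\int[mu]_(x in B) f x)%E.
pose Ig := fine (\int[mu]_(x in B) g x)%E.
pose JF := fine (\int[nu]_(x in B) conjugate F x)%E.
pose Jf := fine (\int[nu]_(x in B) conjugate f x)%E.
have kF : kantorovich mu nu F = (IF + JF)%:E.
  by rewrite kE// EFinD /IF /JF !fineK//; exact: integrable_fin_num.
have kf : kantorovich mu nu f = (If + Jf)%:E.
  by rewrite kE// EFinD /If /Jf !fineK//; exact: integrable_fin_num.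
have opt : IF + JF <= Ig + 2^-1 * (JF + Jf).
  rewrite -lee_fin -kF optF; apply: (@le_trans _ _ (kantorovich mu nu g)).
    by apply: ereal_inf_lbound; exists g.
  rewrite kE// EFinD /Ig fineK; last exact: integrable_fin_num.
  apply: leeD => //; apply: le_trans cgint _.
  rewrite /psi /half_conjugates integralZl//; last exact: integrableD.
  rewrite integralD// EFinM EFinD /JF /Jf !fineK//; exact: integrable_fin_num.
exists (If + Jf - (IF + JF)), P; split.
- by rewrite kF kf.
- apply: measurable_funB; first by apply: measurable_funD; exact: mfine.
  by apply: measurable_funM; [exact: measurable_cst|exact: mfine].
- move=> x v Bx vr.
  have xm : eball (2 * r) (x - v).
    by move: Bx; have := enormD x (- v); rewrite enormN /B /eball /=; lra.
  have xp : eball (2 * r) (x + v).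
    by move: Bx; have := enormD x v; rewrite /B /eball /=; lra.
  have := gle x v xm xp; rewrite gE// -(fineK (lipF.1 _ xm)) -(fineK (lipf.1 _ xp)).
  by rewrite -EFinD -EFinM lee_fin /P; lra.
have -> : (\int[mu]_(x in B) (P x)%:E = \int[mu]_(x in B) (F x + f x - 2%:E * g x))%E.
  by apply: eq_integral => x; rewrite inE => Bx; rewrite FE// fE// gE.
rewrite integralB//; [|exact: integrableD|exact: integrableZl].
rewrite integralD// integralZl//.
rewrite -(fineK (integrable_fin_num mB iF)) -(fineK (integrable_fin_num mB if_)).
rewrite -(fineK (integrable_fin_num mB ig)) lee_fin.
by rewrite -/IF -/If -/Ig; lra.
Qed.

End gap.

(** * The constant *)

Section constants.
Context {K : realType}.

Lemma cube_le_exp4 n : (n.+1%:R : K) ^+ 3 <= 8 * 4 ^+ n.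
Proof.
case: n => [|n]; first by rewrite expr1n expr0; lra.
elim: n => [|n IH]; first by rewrite expr1 -natrX -!natrM ler_nat.
rewrite [4 ^+ n.+2]exprS mulrCA; apply: (@le_trans _ _ (4 * (n.+2%:R : K) ^+ 3)); last first.
  by rewrite ler_wpM2l.
have : 2 <= n.+2%:R :> K by rewrite ler_nat.
rewrite -[n.+3%:R]natr1; move: (n.+2%:R : K) => y y2.
have y3 : 2 * y ^+ 2 <= y ^+ 3 by rewrite exprS ler_wpM2r ?sqr_ge0.
rewrite (_ : (y + 1) ^+ 3 = y ^+ 3 + 3 * y ^+ 2 + 3 * y + 1); last by ring.
nra.
Qed.

(** The left side holds the Gaussian bound for the volume of the ball of radius
    [2 * R].  Up to powers of [d] and a factor [R], the constant [cst_Rd R d] is the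
    volume of a ball whose radius is larger by a fixed factor: this leaves [4 ^+ d],
    which absorbs the powers of [d]. *)
Lemma cst_Rd_ge (d : nat) (R : K) : (0 < d)%N -> 0 < R ->
  216 * d%:R ^+ 4 * (2 * R * Num.sqrt (2 * pi * expR 1 / d%:R)) ^+ d <=
  256 * 8 * R * cst_Rd R d.
Proof.
move=> d0 R0; have D0 : 0 < d%:R :> K by rewrite ltr0n.
have D1 : 1 <= d%:R :> K by rewrite ler1n.
have e2 : 2 <= expR 1 :> K by have := expR_ge1Dx (1 : K); lra.
have pi0 := pi_gt0 K; have pi4 : pi < 4 :> K by have := pihalf_lt2 K; lra.
set D : K := d%:R in D0 D1 *.
pose A : K := 64 * pi * expR 1 / (D / 2 + 1).
pose b := Num.sqrt (2 * pi * expR 1 / D).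
have A0 : 0 <= A by rewrite divr_ge0 ?mulr_ge0 ?expR_ge0 ?ltW//; lra.
have powA : A `^ (D / 2) = Num.sqrt A ^+ d.
  by rewrite -powR12_sqrt// -powR_mulrn ?powR_ge0// -powRrM mulrC.
have Ab : 4 * b <= Num.sqrt A.
  rewrite /b -[X in X * _](@ger0_norm _ 4)// -sqrtr_sqr -sqrtrM ?sqr_ge0// ler_wsqrtr//.
  rewrite /A ler_pdivlMr; last lra.
  rewrite [leLHS](_ : _ = 16 * pi * expR 1 * ((D + 2) / D)); last by field; rewrite gt_eqF.
  rewrite [leRHS](_ : _ = 16 * pi * expR 1 * 4); last by ring.
  rewrite ler_pM2l ?mulr_gt0 ?expR_gt0//; rewrite ler_pdivrMr//; lra.
have b0 : 0 <= b by exact: sqrtr_ge0.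
have Abd : 4 ^+ d * b ^+ d <= Num.sqrt A ^+ d.
  by rewrite -exprMn ler_pXn2r ?nnegrE ?mulr_ge0 ?sqrtr_ge0.
pose s1 : K := Num.sqrt (2 * pi); pose s2 := Num.sqrt (D / 2 + 1).
have s10 : 0 < s1 by rewrite sqrtr_gt0 mulr_gt0.
have s20 : 0 < s2 by rewrite sqrtr_gt0; lra.
have s13 : s1 <= 3.
  rewrite -[leRHS]ger0_norm// -sqrtr_sqr ler_wsqrtr//; lra.
have s2D : s2 <= D + 1.
  have h : 0 <= D + 1 by lra.
  rewrite -[leRHS]ger0_norm// -sqrtr_sqr ler_wsqrtr//; nra.
have q0 : 2 / (3 * (D + 1)) <= expR 1 / (s1 * s2).
  rewrite ler_pdivlMr ?mulr_gt0// mulrAC ler_pdivrMr; last lra.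
  apply: ler_pM; rewrite ?mulr_ge0 ?(ltW s10) ?(ltW s20)//.
  by apply: ler_pM; rewrite ?(ltW s10) ?(ltW s20).
rewrite /cst_Rd -/D -/s1 -/s2 -/A powA exprMn -/b.
have := cube_le_exp4 d; rewrite -[d.+1%:R]natr1 -/D => cub.
have -> : (2 * R) ^+ d = (2 * R) * (2 * R) ^+ d.-1 by rewrite -exprS prednK.
have : 0 <= (2 * R) ^+ d.-1 by rewrite exprn_ge0// mulr_ge0// ltW.
move: ((2 * R) ^+ d.-1) => w w0.
set q := expR 1 / _ in q0 *.
rewrite [leRHS](_ : _ = (R * w * D ^+ 2) * (256 * 8 * 4 * 48 * (q * Num.sqrt A ^+ d))); last by ring.
rewrite [leLHS](_ : _ = (R * w * D ^+ 2) * (432 * (D ^+ 2 * b ^+ d))); last by ring.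
have bd0 : 0 <= b ^+ d by rewrite exprn_ge0.
rewrite ler_wpM2l ?mulr_ge0 ?exprn_ge0 ?(ltW R0) ?(ltW D0)//.
have qge0 : 0 <= 2 / (3 * (D + 1)) by rewrite divr_ge0//; lra.
have := ler_pM qge0 (mulr_ge0 (exprn_ge0 d (ler0n K 4)) bd0) q0 Abd.
move=> h; apply: (@le_trans _ _ (256 * 8 * 4 * 48 * (2 / (3 * (D + 1)) * (4 ^+ d * b ^+ d)))); last first.
  by rewrite ler_wpM2l.
rewrite !mulrA ler_wpM2r//.
rewrite [leRHS](_ : _ = 256 * 512 * (2 * 4 ^+ d) / (D + 1)); last by field; lra.
rewrite ler_pdivlMr; last lra.
have : 0 <= (4 : K) ^+ d by exact: exprn_ge0.
have : D ^+ 2 * (D + 1) <= (D + 1) ^+ 3.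
  by rewrite [leRHS]exprSr ler_wpM2r ?ler_pXn2r ?nnegrE//; lra.
move: cub; move: (4 ^+ d : K) => u; lra.
Qed.

Lemma stability_cst_ge (d : nat) (R M : K) : (0 < d)%N -> 0 < R -> 0 < M ->
  0 < stability_cst d R M /\
  216 * R ^+ 2 * d%:R ^+ 4 * (M * (2 * R * Num.sqrt (2 * pi * expR 1 / d%:R)) ^+ d) <=
  stability_cst d R M ^+ 4.
Proof.
move=> d0 R0 M0; rewrite /stability_cst.
set a := 268 * _; set X := 8 * _ * _ * _; split.
  by rewrite lt_max mulr_gt0 ?sqrtr_gt0.
have cst0 : 0 <= cst_Rd R d.
  rewrite /cst_Rd !mulr_ge0 ?powR_ge0 ?exprn_ge0 ?divr_ge0 ?expR_ge0 ?sqrtr_ge0//.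
  by rewrite mulr_ge0// ltW.
have X0 : 0 <= X.
  by apply: mulr_ge0 => //; rewrite !mulr_ge0 ?exprn_ge0// ltW.
apply: (@le_trans _ _ ((4 * X `^ (1 / 4)) ^+ 4)); last first.
  have a0 : 0 <= 4 * X `^ (1 / 4) by rewrite mulr_ge0 ?powR_ge0.
  by rewrite ler_pXn2r ?nnegrE ?le_max ?a0 ?orbT// lexx orbT.
rewrite [(4 * _) ^+ 4]exprMn -(powR_mulrn 4 (powR_ge0 _ _)) -powRrM.
rewrite (_ : 1 / 4 * 4%:R = 1); last by field.
rewrite powRr1// /X.
have := cst_Rd_ge d0 R0; set V := (_ * _) ^+ d; set c := cst_Rd R d => h.
have RM : 0 <= R ^+ 2 * M by rewrite mulr_ge0 ?exprn_ge0// ltW.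
have := ler_wpM2l RM h; rewrite (_ : 4 ^+ 4 = 256); last by rewrite -natrX.
lra.
Qed.

(** With [delta = a ^+ 4], the trivial bound [3 * R * D] is enough when
    [3 * R * D <= C * a].  Otherwise, for positive [a], [t = 2 * D * a ^+ 3 / C] is an
    admissible scale and both terms of the scale-dependent bound are at most [C * a / 2]. *)
Lemma optimal_scale (D R m C delta I : K) : 1 <= D -> 0 < R -> 1 <= m -> 0 < C ->
  216 * R ^+ 2 * D ^+ 4 * m <= C ^+ 4 -> 0 <= delta ->
  (forall t, 0 < t < R / 2 -> I <= D * delta / t + 6 * D * m * t) ->
  I <= 3 * R * D -> I <= C * delta `^ (1 / 4).
Proof.
move=> D1 R0 m1 C0 CD delta0 It I3.
set a := delta `^ (1 / 4); have a0 : 0 <= a by exact: powR_ge0.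
have da : delta = a ^+ 4.
  rewrite -(powR_mulrn 4 a0) -powRrM (_ : 1 / 4 * 4%:R = 1); last by field.
  by rewrite powRr1.
have [Ca|Ca] := leP (3 * R * D) (C * a); first exact: le_trans Ca.
have D0 : 0 < D by lra.
have m0 : 0 < m by lra.
(* For a zero gap the bound is linear in [t], and [t] is arbitrarily small. *)
have [az|an0] := eqVneq a 0.
  rewrite az mulr0 leNgt; apply/negP => I0.
  pose t := Num.min (R / 4) (I / (12 * D * m)).
  have Dm : 0 < 12 * D * m by rewrite !mulr_gt0.
  have t0 : 0 < t by rewrite lt_min !divr_gt0.
  have tR : t < R / 2 by rewrite gt_min; apply/orP; left; lra.
  have : I <= 6 * D * m * t.
    by have := It t; rewrite t0 tR da az expr0n /= mulr0 mul0r add0r; apply.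
  have : t <= I / (12 * D * m) by rewrite ge_min lexx orbT.
  rewrite ler_pdivlMr// => h1 h2; nra.
have {an0}a0 : 0 < a by rewrite lt_def an0.
pose t := 2 * D * a ^+ 3 / C.
have t0 : 0 < t by rewrite divr_gt0 ?mulr_gt0 ?exprn_gt0.
have Ca0 : 0 <= C * a by rewrite mulr_ge0 ?ltW.
have RD0 : 0 < 3 * R * D by rewrite !mulr_gt0.
have Ca2 : (C * a) ^+ 2 <= (3 * R * D) ^+ 2 by rewrite ler_pXn2r ?nnegrE// ltW.
have Ca3 : (C * a) ^+ 3 <= (3 * R * D) ^+ 3 by rewrite ler_pXn2r ?nnegrE// ltW.
have C3 : 0 < C ^+ 3 by rewrite exprn_gt0.
have C2 : 0 < C ^+ 2 by rewrite exprn_gt0.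
have D4 : 0 < R ^+ 2 * D ^+ 4 by rewrite mulr_gt0 ?exprn_gt0.
have tR : t < R / 2.
  rewrite ltr_pdivrMr// -(ltr_pM2l C3).
  rewrite (_ : C ^+ 3 * (2 * D * a ^+ 3) = 2 * D * (C * a) ^+ 3); last by ring.
  rewrite (_ : C ^+ 3 * (R / 2 * C) = R / 2 * C ^+ 4); last by ring.
  apply: (@le_lt_trans _ _ (2 * D * (3 * R * D) ^+ 3)).
    by rewrite ler_wpM2l// mulr_ge0// ltW.
  rewrite (_ : 2 * D * (3 * R * D) ^+ 3 = R / 2 * (108 * (R ^+ 2 * D ^+ 4))); last by field.
  rewrite ltr_pM2l ?divr_gt0//; apply: lt_le_trans CD.
  rewrite -!mulrA; move: D4; rewrite -mulrA; set w := R ^+ 2 * D ^+ 4 => w0.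
  by rewrite !mulrA -/w; nra.
have h1 : D * delta / t = C * a / 2.
  by rewrite da /t; field; rewrite !gt_eqF.
have h2 : 6 * D * m * t <= C * a / 2.
  rewrite (_ : 6 * D * m * t = (a / C) * (12 * D ^+ 2 * m * a ^+ 2)); last first.
    by rewrite /t; field; rewrite gt_eqF.
  rewrite (_ : C * a / 2 = (a / C) * (C ^+ 2 / 2)); last by field; rewrite gt_eqF.
  rewrite ler_pM2l ?divr_gt0// -(ler_pM2l C2).
  rewrite (_ : C ^+ 2 * (C ^+ 2 / 2) = C ^+ 4 / 2); last by ring.
  rewrite [leLHS](_ : _ = 12 * D ^+ 2 * m * (C * a) ^+ 2); last by ring.
  apply: (@le_trans _ _ (12 * D ^+ 2 * m * (3 * R * D) ^+ 2)).
    by rewrite ler_wpM2l// !mulr_ge0 ?exprn_ge0// ltW.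
  by move: CD; lra.
have := It t; rewrite t0 tR => /(_ isT); rewrite h1; lra.
Qed.

End constants.

(** * Stability of gradients *)

Section stability.
Context {K : realType} {d : nat}.
Variables (mu nu : probability 'rV[K]_d K) (R M : K).
Hypothesis d0 : (0 < d)%N.
Hypothesis R0 : 0 < R.
Hypothesis M0 : 0 < M.
Hypothesis muR : msupport mu `<=` eball R.
Hypothesis nuR : msupport nu `<=` eball R.
Hypothesis muM : forall A : set 'rV[K]_d, measurable A -> (mu A <= M%:E * lebesgue_rV d A)%E.

Let V : K := fine (lebesgue_rV d (eball (2 * R))).

Let VE : lebesgue_rV d (eball (2 * R)) = V%:E.
Proof.
rewrite /V fineK// ge0_fin_numE//; apply: lebesgue_rV_eball_lty => //.
exact: mulr_gt0.
Qed.

Let V0 : 0 <= V. Proof. by rewrite /V fine_ge0. Qed.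

(** A probability of density at most [M] does not fit into a ball of volume less than
    [M^-1]. *)
Let MV : 1 <= M * V.
Proof.
rewrite -lee_fin EFinM -VE -(probability_eball muR).
apply: le_trans (muM (measurable_eball R)) _.
rewrite lee_wpmul2l ?lee_fin ?(ltW M0)//; apply: le_measure; rewrite ?inE.
- exact: measurable_eball.
- exact: measurable_eball.
- by move=> x; rewrite /eball /= => /lt_trans; apply; rewrite ltr_pMl// ltr1n.
Qed.

Section potential.
Variables (h : 'rV[K]_d -> \bar K) (L : K).
Hypothesis Gh : Gamma0 h.
Hypothesis L0 : 0 <= L.
Hypothesis lh : elipschitz_on (eball (2 * R)) L h.

Let H := fine \o h.

Lemma Gamma0_convex_ball : convex_ball (2 * R) H.
Proof. by apply: econvex_ball => [|x]; [case: Gh|exact: lh.1]. Qed.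

Lemma Gamma0_measurable_fine : measurable_fun setT H.
Proof. by case: Gh => _ _ /lsc_measurable mh _; exact: measurableT_comp. Qed.

Lemma elipschitz_fine : lipschitz_ball (2 * R) L H.
Proof.
move=> x y xr yr; have := lh.2 x y xr yr; rewrite /H /=.
by rewrite -(fineK (lh.1 _ xr)) -(fineK (lh.1 _ yr)) -EFinB abse_EFin lee_fin.
Qed.

Let inB x t (i : 'I_d) : eball R x -> `|t| < R -> eball (2 * R) (x + t *: delta_mx ord0 i).
Proof.
have := enormD x (t *: delta_mx ord0 i); rewrite enorm_delta /eball /= => h1 h2 h3; lra.
Qed.

Lemma sdiff_delta_ge0 x t (i : 'I_d) : eball R x -> `|t| < R ->
  0 <= sdiff H (t *: delta_mx ord0 i) x.
Proof.
move=> xR tR; apply: (sdiff_ge0 Gamma0_convex_ball); first exact: inB.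
by rewrite -scaleNr; apply: inB; rewrite ?normrN.
Qed.

Lemma integral_mu_sdiff_le (i : 'I_d) t : 0 < t < R / 2 ->
  (\int[mu]_(x in eball R) (sdiff H (t *: delta_mx ord0 i) x)%:E <=
   (2 / R * L * (M * V) * t ^+ 2)%:E)%E.
Proof.
move=> /andP[t0 tR]; have tn : enorm (t *: delta_mx ord0 i : 'rV[K]_d) = t.
  by rewrite enorm_delta gtr0_norm.
apply: (@le_trans _ _ (M%:E * \int[lebesgue_rV d]_(x in eball R)
    (sdiff H (t *: delta_mx ord0 i) x)%:E)%E).
  apply: ge0_integral_density_le => //; first exact: ltW.
  - exact: measurable_eball.
  - apply: measurable_funTS; apply/measurable_EFinP; apply: measurable_sdiff.
    exact: Gamma0_measurable_fine.
  - move=> x xR; rewrite lee_fin sdiff_delta_ge0// gtr0_norm//; lra.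
rewrite [leRHS](_ : _ = (M%:E * ((2 / R * L * t ^+ 2)%:E * V%:E))%E); last first.
  by rewrite -!EFinM; congr _%:E; ring.
rewrite lee_wpmul2l ?lee_fin ?(ltW M0)//.
have := @integral_sdiff_le _ _ H (t *: delta_mx ord0 i) R L d0 R0 L0
  Gamma0_measurable_fine elipschitz_fine.
rewrite tn VE; apply => // x xR; apply: (sdiff_ge0 Gamma0_convex_ball).
  move: xR; have := enormD x (t *: delta_mx ord0 i); rewrite tn /eball /=; lra.
move: xR; have := enormD x (- (t *: delta_mx ord0 i)); rewrite enormN tn /eball /=; lra.
Qed.

Lemma negligible_not_derivable_delta (i : 'I_d) :
  mu.-negligible [set x | eball R x /\ ~ derivable H x (delta_mx ord0 i)].
Proof.
apply: (@negligible_not_derivable _ _ _ _ (2 / R * L * (M * V))) => //.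
- by rewrite !mulr_ge0 ?invr_ge0// ltW.
- exact: Gamma0_convex_ball.
- exact: Gamma0_measurable_fine.
- exact: integral_mu_sdiff_le.
Qed.

Lemma derive_bound x (i : 'I_d) : eball R x -> derivable H x (delta_mx ord0 i) ->
  `|'D_(delta_mx ord0 i) H x| <= L.
Proof.
move=> xR dH; have R20 : 0 < R / 2 by rewrite divr_gt0.
have xB : eball (2 * R) x by move: xR; rewrite /eball /=; lra.
have bnd s : `|s| = R / 2 -> s * 'D_(delta_mx ord0 i) H x <= L * (R / 2).
  move=> sR; have xs : eball (2 * R) (x + s *: delta_mx ord0 i).
    by apply: inB => //; rewrite sR; lra.
  apply: le_trans (derive_le Gamma0_convex_ball xB xs dH) _.
  apply: le_trans (ler_norm _) _; apply: le_trans (elipschitz_fine xs xB) _.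
  by rewrite addrAC subrr add0r enorm_delta sR.
have h1 := bnd (R / 2) (gtr0_norm R20).
have := bnd (- (R / 2)); rewrite normrN gtr0_norm// => /(_ erefl) h2.
rewrite ler_norml; apply/andP; split; rewrite -(ler_pM2r R20); lra.
Qed.

End potential.


Variables F f : 'rV[K]_d -> \bar K.
Hypothesis optF : brenier_potential mu nu F.
Hypothesis lipF : elipschitz_on setT R F.
Hypothesis Gf : Gamma0 f.
Hypothesis lipf : elipschitz_on (eball (2 * R)) (2 * R) f.
Hypothesis lipc : elipschitz_on (eball (2 * R)) (2 * R) (conjugate f).

Let I : \bar K := (\int[mu]_x (enorm (gradient F x - gradient f x))%:E)%E.

Let GF : Gamma0 F. Proof. exact: optF.1. Qed.

Let lipFB : elipschitz_on (eball (2 * R)) R F.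
Proof. by split => [x _|x y _ _]; [exact: lipF.1|exact: lipF.2]. Qed.

Let R20 : 0 <= 2 * R. Proof. by rewrite mulr_ge0// ltW. Qed.

Let good : set 'rV[K]_d := [set x | eball R x /\ forall i : 'I_d,
  derivable (fine \o F) x (delta_mx ord0 i) /\ derivable (fine \o f) x (delta_mx ord0 i)].

Let negligible_bad : mu.-negligible (~` good).
Proof.
pose N k := if (insub k : option 'I_d) is Some i then
  [set x | eball R x /\ ~ derivable (fine \o F) x (delta_mx ord0 i)] `|`
  [set x | eball R x /\ ~ derivable (fine \o f) x (delta_mx ord0 i)] else set0.
have N0 k : mu.-negligible (N k).
  rewrite /N; case: insubP => [i _ _|_]; last exact: negligible_set0.
  apply: negligibleU; first exact: (negligible_not_derivable_delta GF (ltW R0) lipFB).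
  exact: (negligible_not_derivable_delta Gf R20 lipf).
apply: negligibleS (negligibleU (negligible_setC_msupport mu) (negligible_bigcup N0)).
move=> x xbad; have [xS|] := pselect (msupport mu x); last by left.
right; apply: contrapT => xN; apply: xbad; split; first exact: muR.
move=> i; have {}xN : ~ N i x by move=> Nx; apply: xN; exists (i : nat).
move: xN; rewrite /N; case: insubP => [k _ /val_inj ->|]; last by rewrite ltn_ord.
by move=> /not_orP[h1 h2]; split; apply: contrapT => nd; [apply: h1|apply: h2]; split => //;
  exact: muR.
Qed.

Lemma gradient_diff_le x : enorm (gradient F x - gradient f x) <=
  \sum_(i < d) `|'D_(delta_mx ord0 i) (fine \o F) x - 'D_(delta_mx ord0 i) (fine \o f) x|.
Proof.
apply: le_trans (enorm_le_sum _) _; apply: ler_sum => i _.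
by rewrite !mxE.
Qed.


(** Partial derivatives are bounded by Lipschitz constants. *)
Lemma integral_gradient_diff_trivial : (I <= (3 * R * d%:R)%:E)%E.
Proof.
rewrite -[leRHS]mule1 -(probability_setT mu) -integral_cst//.
apply: (ge0_negligible_le_integral negligible_bad) => //.
- by move=> x; rewrite lee_fin enorm_ge0.
- by move=> x; rewrite lee_fin !mulr_ge0// ltW.
move=> x /contrapT[xR dx]; rewrite lee_fin; apply: le_trans (gradient_diff_le x) _.
rewrite mulr_natr -[X in _ *+ X](card_ord d) -sumr_const; apply: ler_sum => i _.
have := derive_bound GF lipFB xR (dx i).1.
have := derive_bound Gf lipf xR (dx i).2.
have := ler_normB ('D_(delta_mx ord0 i) (fine \o F) x) ('D_(delta_mx ord0 i) (fine \o f) x).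
lra.
Qed.

Section scale.
Variables (delta : K) (P : 'rV[K]_d -> K) (t : K).
Hypothesis mP : measurable_fun setT P.
Hypothesis Ple : forall x v, eball R x -> enorm v < R ->
  fine (F x) - fine (F (x - v)) + (fine (f x) - fine (f (x + v))) <= P x.
Hypothesis Pint : (\int[mu]_(x in eball R) (P x)%:E <= delta%:E)%E.
Hypothesis t_itv : 0 < t < R / 2.

Let SF i x := sdiff (fine \o F) (t *: delta_mx ord0 i) x.
Let Sf i x := sdiff (fine \o f) (t *: delta_mx ord0 i) x.

Let tR : `|t| < R.
Proof.
have /andP[t0 tR2] := t_itv; rewrite gtr0_norm//.
by apply: lt_trans tR2 _; rewrite ltr_pdivrMr// ltr_pMr// ltr1n.
Qed.

(** Both potentials lie above their tangents, so moving one of them forward and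
    the other backward by [t] detects the difference of the slopes up to the second
    differences. *)
Lemma derive_diff_le x (i : 'I_d) : good x ->
  `|'D_(delta_mx ord0 i) (fine \o F) x - 'D_(delta_mx ord0 i) (fine \o f) x| <=
  t^-1 * (P x + SF i x + Sf i x).
Proof.
move=> [xR /(_ i)[dF df]]; have /andP[t0 _] := t_itv.
have R_gt0 := R0.
have xB : eball (2 * R) x by move: xR; rewrite /eball /=; lra.
have inB s : `|s| < R -> eball (2 * R) (x + s *: delta_mx ord0 i).
  have := enormD x (s *: delta_mx ord0 i); rewrite enorm_delta; move: xR.
  rewrite /eball /=; lra.
have tNR : `|- t| < R by rewrite normrN.
have F1 := derive_le (Gamma0_convex_ball GF lipFB) xB (inB _ tR) dF.
have F2 := derive_le (Gamma0_convex_ball GF lipFB) xB (inB _ tNR) dF.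
have f1 := derive_le (Gamma0_convex_ball Gf lipf) xB (inB _ tR) df.
have f2 := derive_le (Gamma0_convex_ball Gf lipf) xB (inB _ tNR) df.
have P1 := @Ple x (t *: delta_mx ord0 i) xR; have P2 := @Ple x (- t *: delta_mx ord0 i) xR.
rewrite !enorm_delta in P1 P2; have {}P1 := P1 tR; have {}P2 := P2 tNR.
move: F2 f2 P2; rewrite !scaleNr !opprK => F2 f2 P2.
rewrite ler_pdivlMl// -[X in X * _](gtr0_norm t0) -normrM ler_norml /SF /Sf /sdiff.
rewrite /= in F1 F2 f1 f2 *.
by apply/andP; split; lra.
Qed.

(** The integral of [P] contributes [delta / t] per coordinate; the second
    differences contribute [2 / R * L * (M * V) * t] with [L = R] for [F] and
    [L = 2 * R] for [f]. *)
Lemma integral_gradient_diff_scale :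
  (I <= (d%:R * delta / t + 6 * d%:R * (M * V) * t)%:E)%E.
Proof.
have /andP[t0 tR2] := t_itv; have tV0 : 0 <= t^-1 by rewrite invr_ge0 ltW.
pose q i x := t^-1 * (P x + SF i x + Sf i x).
have mB : measurable (@eball K d R) by exact: measurable_eball.
have mSF i : measurable_fun setT (SF i).
  by apply: measurable_sdiff; exact: Gamma0_measurable_fine.
have mSf i : measurable_fun setT (Sf i).
  by apply: measurable_sdiff; exact: Gamma0_measurable_fine.
have mq i : measurable_fun setT (q i).
  apply: measurable_funM; first exact: measurable_cst.
  by apply: measurable_funD => //; exact: measurable_funD.
have P0 x : eball R x -> 0 <= P x.
  by move=> xR; have := @Ple x 0 xR; rewrite enorm0 subr0 addr0 !subrr addr0; apply.
have SF0 i x : eball R x -> 0 <= SF i x.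
  by move=> xR; exact: (sdiff_delta_ge0 GF lipFB).
have Sf0 i x : eball R x -> 0 <= Sf i x.
  by move=> xR; exact: (sdiff_delta_ge0 Gf lipf).
have S0 i x : eball R x -> 0 <= P x + SF i x + Sf i x.
  by move=> xR; apply: addr_ge0; [apply: addr_ge0; [exact: P0|exact: SF0]|exact: Sf0].
have q0 i x : eball R x -> 0 <= q i x.
  by move=> xR; rewrite mulr_ge0// S0.
apply: (@le_trans _ _ (\int[mu]_x (((fun x => \sum_(i < d) (q i x)%:E) \_ (eball R)) x))%E).
  apply: (ge0_negligible_le_integral negligible_bad).
  - apply/(measurable_restrictT _ _).1 => //; apply: measurable_funTS.
    by apply: emeasurable_sum => i; exact/measurable_EFinP.
  - by move=> x; rewrite lee_fin enorm_ge0.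
  - apply: erestrict_ge0 => x xR; apply: sume_ge0 => i _; rewrite lee_fin; exact: q0.
  move=> x /contrapT gx; have [xR _] := gx.
  rewrite patchE mem_set// sumEFin lee_fin; apply: le_trans (gradient_diff_le x) _.
  by apply: ler_sum => i _; exact: derive_diff_le.
have mE (h : 'rV[K]_d -> K) : measurable_fun setT h ->
    measurable_fun (eball R) (fun x => (h x)%:E).
  by move=> mh; apply: measurable_funTS; exact/measurable_EFinP.
rewrite -integral_mkcond.
rewrite (ge0_integral_sum mu mB (fun i => mE (q i) (mq i)))//.
have qint i : (\int[mu]_(x in eball R) (q i x)%:E <= (delta / t + 6 * (M * V) * t)%:E)%E.
  have S0E x : eball R x -> (0 <= (P x + SF i x + Sf i x)%:E)%E.
    by move=> xR; rewrite lee_fin S0.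
  have mS : measurable_fun (eball R) (fun x => (P x + SF i x + Sf i x)%:E).
    by apply: mE; apply: measurable_funD => //; exact: measurable_funD.
  under eq_integral do rewrite EFinM.
  rewrite (ge0_integralZl _ mB mS S0E) ?lee_fin//.
  under eq_integral do rewrite EFinD.
  rewrite (ge0_integralD _ mB _ (mE _ _) _ (mE _ (mSf i)))//; last 3 first.
  - by move=> x xR; rewrite lee_fin; apply: addr_ge0; [exact: P0|exact: SF0].
  - exact: measurable_funD.
  - by move=> x xR; rewrite lee_fin; exact: Sf0.
  under eq_integral do rewrite EFinD.
  rewrite (ge0_integralD _ mB _ (mE _ mP) _ (mE _ (mSF i)))//; last first.
    by move=> x xR; rewrite lee_fin; exact: SF0.
  have iF := integral_mu_sdiff_le GF (ltW R0) lipFB i t_itv.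
  have if_ := integral_mu_sdiff_le Gf R20 lipf i t_itv.
  apply: (@le_trans _ _ ((t^-1)%:E * (delta%:E + (2 / R * R * (M * V) * t ^+ 2)%:E +
      (2 / R * (2 * R) * (M * V) * t ^+ 2)%:E))%E).
    by rewrite lee_wpmul2l ?lee_fin//; apply: leeD => //; exact: leeD.
  rewrite -!EFinD -EFinM lee_fin le_eqVlt; apply/orP; left; apply/eqP.
  by field; rewrite !gt_eqF.
apply: le_trans (lee_sum _ (fun i _ => qint i)) _.
rewrite sumEFin sumr_const card_ord lee_fin -mulr_natl le_eqVlt; apply/orP; left; apply/eqP.
by ring.
Qed.

End scale.

Lemma gradient_stability : exists delta : K,
  (kantorovich mu nu f - kantorovich mu nu F = delta%:E)%E /\
  (I <= (stability_cst d R M * delta `^ (1 / 4))%:E)%E.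
Proof.
have [delta [P [kE mP Ple Pint]]] := kantorovich_gap R0 muR nuR lipFB lipf lipc optF Gf.
exists delta; split => //.
have I0 : (0 <= I)%E by apply: integral_ge0 => x _; rewrite lee_fin enorm_ge0.
have I3 := integral_gradient_diff_trivial.
have Ifin : I \is a fin_num by rewrite ge0_fin_numE// (le_lt_trans I3)// ltry.
have delta0 : 0 <= delta.
  rewrite -lee_fin; apply: le_trans Pint; apply: integral_ge0 => x xR; rewrite lee_fin.
  by have := Ple x 0 xR; rewrite enorm0 subr0 addr0 !subrr addr0; apply.
have [C0 C4] := stability_cst_ge d0 R0 M0.
have VV : V <= (2 * R * Num.sqrt (2 * pi * expR 1 / d%:R)) ^+ d.
  by rewrite -lee_fin -VE; apply: lebesgue_rV_eball_le => //; exact: mulr_gt0.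
rewrite -(fineK Ifin) lee_fin.
apply: (@optimal_scale _ d%:R R (M * V)) => //.
- by rewrite ler1n.
- apply: le_trans C4; rewrite ler_wpM2l ?mulr_ge0 ?exprn_ge0 ?(ltW R0)//.
  by rewrite ler_wpM2l// ltW.
- move=> t t_itv; rewrite -lee_fin fineK//.
  exact: (integral_gradient_diff_scale mP Ple Pint t_itv).
by rewrite -lee_fin fineK.
Qed.

End stability.

Theorem corollary4p7 (K : realType) (d : nat) (R M : K) :
  (0 < d)%N -> 0 < R -> 0 < M ->
  exists C : K, [/\ 0 < C, C = stability_cst d R M &
    forall mu nu : probability 'rV[K]_d K,
    compactly_supported_in mu (eball R) ->
    compactly_supported_in nu (eball R) ->
    (forall A : set 'rV[K]_d, measurable A ->
      (mu A <= M%:E * lebesgue_rV d A)%E) ->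
    forall phibar : 'rV[K]_d -> \bar K,
    brenier_potential mu nu phibar ->
    elipschitz_on setT R phibar ->
    forall phi : 'rV[K]_d -> \bar K,
    Gamma0 phi ->
    elipschitz_on (eball (2 * R)) (2 * R) phi ->
    elipschitz_on (eball (2 * R)) (2 * R) (conjugate phi) ->
    (\int[mu]_x (enorm (gradient phibar x - gradient phi x)%R)%:E <=
      C%:E * ((\int[mu]_x phi x + \int[nu]_y conjugate phi y)
            - (\int[mu]_x phibar x + \int[nu]_y conjugate phibar y))
            `^ (1 / 4)%R)%E].
Proof.
move=> d0 R0 M0; exists (stability_cst d R M); split => //.
  by case: (stability_cst_ge d0 R0 M0).
move=> mu nu [_ muR] [_ nuR] muM F optF lipF f Gf lipf lipc.
have [delta [kE le]] := gradient_stability d0 R0 M0 muR nuR muM optF lipF Gf lipf lipc.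
by rewrite /kantorovich in kE; rewrite kE poweR_EFin -EFinM.
Qed.
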